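(* For every integer $k\ge 3$, it is NP-complete to decide, given a graph $H$ and two distinct vertices $u,v\in V(H)$, whether there exists a $u,v$-separator $S$ in $H$ such that $\alpha(H[S])\le k$.
   Context: A $u,v$-separator is a set $S\subseteq V(H)\setminus\{u,v\}$ such that $H\setminus S$ contains no path from $u$ to $v$. $\alpha(H[S])$ is the maximum size of an independent set in the induced subgraph $H[S]$. *)

(* Defs.v *)
From mathcomp Require Import all_boot all_order all_algebra.
Set Implicit Arguments.
Unset Strict Implicit.
Unset Printing Implicit Defensive.

(* [None] is the blank, [Some (inl b)] an input/output bit, and [Some (inr a)]
   an auxiliary work symbol of the machine. *)
Definition symbol (A : finType) : finType := option (bool + A).

Variant move := MoveLeft | Stay | MoveRight.

(* A two-way infinite tape: [before] lists the cells to the left of the head,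
   nearest first; [after] starts with the scanned cell and goes right.  All the
   cells beyond the ends of the two lists are blank. *)
Record tape (A : finType) := Tape {
  before : seq (symbol A);
  after : seq (symbol A) }.

Definition scan (A : finType) (t : tape A) : symbol A := head None (after t).

Definition write_move (A : finType) (t : tape A) (am : symbol A * move) :
    tape A :=
  let: (a, m) := am in
  let l := before t in
  let r := behead (after t) in
  match m with
  | MoveLeft => Tape (behead l) (head None l :: a :: r)
  | Stay => Tape l (a :: r)
  | MoveRight => Tape (a :: l) r
  end.

Record machine := Machine {
  work_tapes : nat;
  work_symbol : finType;
  state : finType;
  start : state;
  halting : pred state;
  transition :
    state -> {ffun 'I_work_tapes.+1 -> symbol work_symbol} ->
    state * {ffun 'I_work_tapes.+1 -> symbol work_symbol * move} }.

Definition config (M : machine) : Type :=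
  state M * {ffun 'I_(work_tapes M).+1 -> tape (work_symbol M)}.

Definition step (M : machine) (c : config M) : config M :=
  let: (q, ts) := c in
  if halting q then c else
  let: (q', acts) := transition q [ffun i => scan (ts i)] in
  (q', [ffun i => write_move (ts i) (acts i)]).

(* The input is on tape 0, with the head on its first bit. *)
Definition initial (M : machine) (x : seq bool) : config M :=
  (start M,
   [ffun i => Tape [::] (if i == ord0 then [seq Some (inl b) | b <- x]
                         else [::])]).

Fixpoint leading_bits (A : finType) (s : seq (symbol A)) : seq bool :=
  if s is Some (inl b) :: s' then b :: leading_bits s' else [::].

(* The output is the maximal block of bits on tape 0 that starts at the head.
   Halting configurations are fixed by [step], so that this says that [M] halts
   on [x] after at most [t] steps, with output [y]. *)
Definition outputs_within (M : machine) (x : seq bool) (t : nat)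
    (y : seq bool) : Prop :=
  let c := iter t (@step M) (initial M x) in
  halting c.1 /\ leading_bits (after (c.2 ord0)) = y.

Definition poly_time_computable (f : seq bool -> seq bool) : Prop :=
  exists (M : machine) (p : {poly nat}),
    forall x, outputs_within M x p.[size x]%R (f x).

Definition poly_time_decidable (V : pred (seq bool)) : Prop :=
  poly_time_computable (fun x => [:: V x]).

Definition language := seq bool -> Prop.

(* Every bit of [x] is preceded by [true]; the first [false] in an even position,
   counting from 0, is followed by [w]. *)
Definition pair_word (x w : seq bool) : seq bool :=
  flatten [seq [:: true; b] | b <- x] ++ false :: w.

Definition in_NP (L : language) : Prop :=
  exists (V : pred (seq bool)) (p : {poly nat}),
    poly_time_decidable V /\
    forall x, L x <->
      exists w, (size w <= p.[size x]%R)%N /\ V (pair_word x w).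

Definition poly_time_reducible (L1 L2 : language) : Prop :=
  exists f, poly_time_computable f /\ forall x, L1 x <-> L2 (f x).

Definition NP_hard (L : language) : Prop :=
  forall L', in_NP L' -> poly_time_reducible L' L.

Definition NP_complete (L : language) : Prop := in_NP L /\ NP_hard L.

Definition simple_graph (T : finType) (e : rel T) : Prop :=
  symmetric e /\ irreflexive e.

Definition separator (T : finType) (e : rel T) (u v : T) (S : {set T}) : Prop :=
  [/\ u \notin S, v \notin S &
      ~ exists p : seq T,
          [/\ path e u p, last u p = v, uniq (u :: p) &
              {in u :: p, forall x, x \notin S}]].

Definition independent (T : finType) (e : rel T) (I : {set T}) : bool :=
  [forall x in I, forall y in I, ~~ e x y].

(* The independent sets of the subgraph induced by [S] are the independent sets
   contained in [S]. *)
Definition alpha (T : finType) (e : rel T) (S : {set T}) : nat :=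
  \max_(I : {set T} | (I \subset S) && independent e I) #|I|.

Definition unary (m : nat) : seq bool := rcons (nseq m true) false.

Definition instance_word (n : nat) (e : rel 'I_n) (u v : 'I_n) : seq bool :=
  unary n ++ [seq e x y | x <- enum 'I_n, y <- enum 'I_n] ++ unary u ++ unary v.

Lemma unary_cat_inj (m m' : nat) (s s' : seq bool) :
  unary m ++ s = unary m' ++ s' -> m = m' /\ s = s'.
Proof.
rewrite /unary; elim: m m' => [|m IH] [|m'] //=; first by case.
by case=> /IH [-> ->].
Qed.

Lemma instance_word_size_inj (n n' : nat) (e : rel 'I_n) (e' : rel 'I_n')
    (u v : 'I_n) (u' v' : 'I_n') :
  instance_word e u v = instance_word e' u' v' -> n = n'.
Proof. by case/unary_cat_inj. Qed.

Lemma instance_word_inj (n : nat) (e e' : rel 'I_n) (u v u' v' : 'I_n) :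
  instance_word e u v = instance_word e' u' v' ->
  [/\ e =2 e', u = u' & v = v'].
Proof.
case/unary_cat_inj=> _ /eqP; rewrite eqseq_cat ?size_allpairs //.
case/andP=> /eqP eqA /eqP /unary_cat_inj [/val_inj eq_u eq_v].
split=> //; last first.
  apply: val_inj; apply: (proj1 (@unary_cat_inj v v' [::] [::] _)).
  by rewrite !cats0.
pose r := [seq (x, y) | x <- enum 'I_n, y <- enum 'I_n].
have eqr : [seq e p.1 p.2 | p <- r] = [seq e' p.1 p.2 | p <- r].
  by rewrite !map_allpairs.
move=> x y; move/eq_in_map: eqr => /(_ (x, y)); apply.
by apply/allpairsP; exists (x, y); rewrite !mem_enum.
Qed.

(* A word that does not encode an instance is not in the language. *)
Definition small_alpha_separator (k : nat) : language := fun word =>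
  exists (n : nat) (e : rel 'I_n) (u v : 'I_n),
    [/\ simple_graph e, u != v, word = instance_word e u v &
        exists S : {set 'I_n}, separator e u v S /\ (alpha e S <= k)%N].

(* Main.v *)
(* NP-hardness.  Let A and B be two copies of a set of elements, with u adjacent
   to A, v adjacent to B, and an edge between the two copies of each element: a
   u,v-separator contains a copy of each element, so it is (at least) a set P of
   elements taken in A and the complement of P taken in B.  The edges inside A and
   inside B are free.  Vertices adjacent to u and v belong to every separator, and
   with k of them, suitably joined to A and B, the condition "independence number
   at most k" becomes: no two conflicting elements in P, and no triangle of B
   outside of P.  This expresses an arbitrary binary constraint satisfaction
   problem, the wide clauses "x takes some value" being cut into triangles.  The
   tableau of a Turing machine is such a problem: if cells are numbered from the
   heads and every cell records the state and the scanned symbols, then all the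
   constraints involve two cells, whatever the number of tapes.

   Polynomial time.  The verifier and the reduction are described by formulas of
   bounded arithmetic (sums, products, bits of the input, quantifiers bounded by
   terms), which are evaluated by programs over stacks, in a number of steps that
   is polynomial; these programs are compiled to multi-tape machines. *)
Require Import Defs.
From mathcomp Require Import all_boot all_order all_algebra.
From mathcomp Require Import zify.
From Stdlib Require Import FunctionalExtensionality.
Set Implicit Arguments.
Unset Strict Implicit.
Unset Printing Implicit Defensive.
Import GRing.Theory.
Local Open Scope nat_scope.

(** * Stack programs and their compilation to Turing machines *)

(** The [k] vertices adjacent to both terminals are pairwise nonadjacent, so they already reach the
    bound [k]. Number 0 is joined to A: a conflicting pair of A replaces one of these vertices by
    two. Numbers 1 and 2 are joined to B: a triangle of B replaces two of them by three. One vertex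
    for A and two for B account for [3 <= k]. The clause that a variable takes some value is cut
    along an enumeration of the values: for each [d], the value is [d], or comes after [d], or comes
    before [d]. The element after [d] conflicts with the one before the successor of [d], and both
    ends of the chain are forbidden. On the machine side, the formula is fixed and each quantifier
    ranges below a polynomially bounded term, so naive evaluation by nested loops is polynomial. A
    reduction is given by its output length and by a formula for bit number [j]. Terms have no
    division, so positions are decoded by bounded search. For membership, the absence of a path is
    certified by a set that contains [u] and cannot be left without entering the separator. Since
    [k] is fixed, all [k.+1]-tuples can be searched. *)

Definition store := nat -> seq bool.

Definition upd (s : store) v w : store := fun u => if u == v then w else s u.

Inductive cmd :=
| Skip
| Push (v : nat) (b : bool)
| Pop (v : nat)
| Seq (c1 c2 : cmd)
| Case (v : nat) (c0 cf ct : cmd)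
| While (v : nat) (c : cmd).

(* The numeral counts the machine steps of the compiled code. *)
Inductive exec : cmd -> nat -> store -> store -> Prop :=
| ExecSkip s : exec Skip 0 s s
| ExecPush v b s : exec (Push v b) 2 s (upd s v (b :: s v))
| ExecPop v s : exec (Pop v) 1 s (upd s v (behead (s v)))
| ExecSeq c1 c2 t1 t2 s s1 s2 :
    exec c1 t1 s s1 -> exec c2 t2 s1 s2 -> exec (Seq c1 c2) (t1 + t2) s s2
| ExecCase v c0 cf ct t s s' :
    exec (if s v is b :: _ then if b then ct else cf else c0) t s s' ->
    exec (Case v c0 cf ct) t.+2 s s'
| ExecWhileNil v c s : s v = [::] -> exec (While v c) 1 s s
| ExecWhileCons v c t1 t2 s s1 s2 :
    s v != [::] -> exec c t1 s s1 -> exec (While v c) t2 s1 s2 ->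
    exec (While v c) (t1 + t2).+2 s s2.

Fixpoint cmd_width c :=
  match c with
  | Skip => 0
  | Push v _ | Pop v => v
  | Seq c1 c2 => maxn (cmd_width c1) (cmd_width c2)
  | Case v c0 cf ct =>
      maxn v (maxn (cmd_width c0) (maxn (cmd_width cf) (cmd_width ct)))
  | While v c => maxn v (cmd_width c)
  end.

Variant instr :=
| IMove (v : nat) (m : move)
| IWrite (v : nat) (b : bool)
| IJump (v a0 af at' : nat).

Fixpoint code_size c :=
  match c with
  | Skip => 0
  | Push _ _ => 2
  | Pop _ => 1
  | Seq c1 c2 => code_size c1 + code_size c2
  | Case _ c0 cf ct => (code_size c0 + code_size cf + code_size ct).+4
  | While _ c => (code_size c).+2
  end.

Definition goto a := IJump 0 a a a.

(* Jump targets are absolute; [p] is the address of the first instruction. *)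
Fixpoint compile p c : seq instr :=
  match c with
  | Skip => [::]
  | Push v b => [:: IMove v MoveLeft; IWrite v b]
  | Pop v => [:: IMove v MoveRight]
  | Seq c1 c2 => compile p c1 ++ compile (p + code_size c1) c2
  | Case v c0 cf ct =>
      let p0 := p.+1 in
      let pf := (p0 + code_size c0).+1 in
      let pt := (pf + code_size cf).+1 in
      let e := (pt + code_size ct).+1 in
      IJump v p0 pf pt :: compile p0 c0 ++ goto e ::
      compile pf cf ++ goto e :: compile pt ct ++ [:: goto e]
  | While v c =>
      let e := (p.+1 + code_size c).+1 in
      IJump v e p.+1 p.+1 :: compile p.+1 c ++ [:: goto p]
  end.

Lemma size_compile p c : size (compile p c) = code_size c.
Proof.
elim: c p => //= [c1 IH1 c2 IH2|v c0 IH0 cf IHf ct IHt|v c IH] p.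
- by rewrite size_cat IH1 IH2.
- do 3!rewrite size_cat /= ?IH0 ?IHf ?IHt; lia.
- by rewrite size_cat /= IH addn1.
Qed.

(** The control state is the address of the next instruction, and the address just past the end is
    the halting state. Bits and the blank suffice as tape alphabet: the blank marks the bottom of a
    stack. *)
Definition code_machine (K : nat) (code : seq instr) : machine :=
  @Machine K void 'I_(size code).+1 ord0 (fun q => (q : nat) == size code)
    (fun q scans =>
       match nth (goto 0) code q with
       | IMove v m =>
           (inord q.+1,
            [ffun i : 'I_K.+1 => (scans i, if (i : nat) == v then m else Stay)])
       | IWrite v b =>
           (inord q.+1,
            [ffun i : 'I_K.+1 => (if (i : nat) == v then Some (inl b) else scans i, Stay)])
       | IJump v a0 af at' =>
           (inord (if scans (inord v) is Some (inl b)
                   then if b then at' else af else a0),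
            [ffun i : 'I_K.+1 => (scans i, Stay)])
       end).

(** The top of the stack is under the head. Nothing is said of the cells on the left: a pop leaves
    its symbol there, and a push moves left and overwrites whatever it finds. *)
Definition represents (w : seq bool) (t : tape void) :=
  exists j, after t = [seq Some (inl b) | b <- w] ++ nseq j None.

Lemma represents_stay w t : represents w t ->
  represents w (write_move t (scan t, Stay)).
Proof.
case: t => l r [j /= def_r]; rewrite /represents /scan /= def_r.
case: w {def_r} => [|b w] /=; last by exists j.
by case: j => [|j]; [exists 1 | exists j.+1].
Qed.

Lemma represents_pop w t : represents w t ->
  represents (behead w) (write_move t (scan t, MoveRight)).
Proof.
case: t => l r [j /= def_r]; rewrite /represents /scan /= def_r.
case: w {def_r} => [|b w] /=; last by exists j.
by case: j => [|j]; [exists 0 | exists j].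
Qed.

Lemma represents_push b w t : represents w t ->
  represents (b :: w)
    (write_move (write_move t (scan t, MoveLeft)) (Some (inl b), Stay)).
Proof.
case: t => l r [j /= def_r]; rewrite /represents /scan /= def_r.
case: w {def_r} => [|b' w] /=; last by exists j.
by case: j => [|j]; [exists 1 | exists j.+1].
Qed.

Lemma represents_scan w t : represents w t ->
  scan t = if w is b :: _ then Some (inl b) else None.
Proof.
by case: t => l r [j]; rewrite /scan /= => ->; case: w => [|b w] //; case: j.
Qed.

Section Compilation.
Variables (K : nat) (code : seq instr).
Let M := code_machine K code.

Definition at_point p (s : store) (c : config M) :=
  nat_of_ord c.1 = p /\ forall i : 'I_K.+1, represents (s i) (c.2 i).

Lemma step_instr p s (c : config M) : p < size code -> at_point p s c ->
  step c =
   let: (q', acts) := @transition M c.1 [ffun i => scan (c.2 i)] in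
   (q', [ffun i => write_move (c.2 i) (acts i)]).
Proof.
by case: c => q ts lt_p [/= def_q _]; rewrite /step /= def_q ltn_eqF.
Qed.

Lemma step_goto p s c a : p < size code -> nth (goto 0) code p = goto a ->
  a <= size code -> at_point p s c -> at_point a s (step c).
Proof.
move=> lt_p def_i le_a cP; rewrite (step_instr lt_p cP).
case: c cP => q ts [/= def_q cP]; rewrite def_q def_i /=.
split=> [|i] /=; last by rewrite !ffunE; apply: represents_stay.
by case: ([ffun _ => _] _) => [[[]|]|] //; rewrite inordK.
Qed.

Lemma step_jump p s c v a0 af at' : p < size code ->
  nth (goto 0) code p = IJump v a0 af at' -> v <= K ->
  a0 <= size code -> af <= size code -> at' <= size code -> at_point p s c ->
  at_point (if s v is b :: _ then if b then at' else af else a0) s (step c).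
Proof.
move=> lt_p def_i le_v le0 lef let' cP; rewrite (step_instr lt_p cP).
case: c cP => q ts [/= def_q cP]; rewrite def_q def_i /=.
split=> [|i] /=; last by rewrite !ffunE; apply: represents_stay.
rewrite ffunE (represents_scan (cP _)) (inordK (le_v : v < K.+1)).
by case: (s v) => [|[] w]; rewrite inordK.
Qed.

Lemma step_pop p s c v : p < size code ->
  nth (goto 0) code p = IMove v MoveRight -> at_point p s c ->
  at_point p.+1 (upd s v (behead (s v))) (step c).
Proof.
move=> lt_p def_i cP; rewrite (step_instr lt_p cP).
case: c cP => q ts [/= def_q cP]; rewrite def_q def_i /=.
split=> [|i] /=; first by rewrite inordK.
rewrite !ffunE /upd; case: eqP => [<-|_]; first exact: represents_pop.
exact: represents_stay.
Qed.

Lemma step_push p s c v b : p.+1 < size code ->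
  nth (goto 0) code p = IMove v MoveLeft ->
  nth (goto 0) code p.+1 = IWrite v b -> at_point p s c ->
  at_point p.+2 (upd s v (b :: s v)) (step (step c)).
Proof.
move=> lt_p def_i def_i' cP; rewrite (step_instr (ltnW lt_p) cP).
case: c cP => q ts [/= def_q cP]; rewrite def_q def_i /=.
rewrite inordK; last by lia.
rewrite ltn_eqF // def_i' /=.
split=> [|i] /=; first by rewrite inordK.
rewrite !ffunE /upd; case: eqP => [<-|_]; first exact: represents_push.
by do 2![apply: represents_stay].
Qed.

(** Jump targets are absolute, so the induction has to treat the code of a command placed anywhere
    inside a larger code. *)
Lemma compile_correct cm t s s' : exec cm t s s' -> cmd_width cm <= K ->
  forall pre post c, code = pre ++ compile (size pre) cm ++ post ->
  at_point (size pre) s c ->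
  at_point (size pre + code_size cm) s' (iter t (@step M) c).
Proof.
have sizeE pre l post : code = pre ++ l ++ post ->
    size code = size pre + size l + size post.
  by move->; rewrite !size_cat addnA.
have nthE pre l post j : code = pre ++ l ++ post -> j < size l ->
    nth (goto 0) code (size pre + j) = nth (goto 0) l j.
  move=> -> lt_j; rewrite nth_cat ltnNge leq_addr /= addKn nth_cat lt_j //.
elim=> {cm t s s'}.
- by move=> s _ pre post c _; rewrite addn0.
- move=> v b s _ pre post c def_c.
  have sz := sizeE _ _ _ def_c; rewrite addn2; apply: step_push.
  + by move: sz => /=; lia.
  + by have := nthE _ _ _ 0 def_c isT; rewrite addn0.
  + by have := nthE _ _ _ 1 def_c isT; rewrite addn1.
- move=> v s _ pre post c def_c; rewrite addn1; apply: step_pop.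
  + by have /= := sizeE _ _ _ def_c; lia.
  + by have := nthE _ _ _ 0 def_c isT; rewrite addn0.
- move=> c1 c2 t1 t2 s s1 s2 _ IH1 _ IH2; rewrite geq_max => /andP[w1 w2].
  move=> pre post c /= def_c cP; rewrite [t1 + t2]addnC iterD.
  have def1 : code = pre ++ compile (size pre) c1 ++
      (compile (size pre + code_size c1) c2 ++ post) by rewrite def_c -!catA.
  have c1P := IH1 w1 _ _ _ def1 cP.
  have szp : size (pre ++ compile (size pre) c1) = size pre + code_size c1.
    by rewrite size_cat size_compile.
  have := IH2 w2 (pre ++ compile (size pre) c1) post.
  by rewrite szp /= addnA; apply=> //; rewrite def_c -!catA.
- move=> v c0 cf ct t s s' _ IH; rewrite !geq_max => /and4P[wv w0 wf wt].
  move=> pre post c def_c cP.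
  have sz := sizeE _ _ _ def_c; rewrite size_compile /= in sz.
  (* One step for the opening jump, [t] for the branch, one for the jump to the common exit [e]. *)
  rewrite [t.+2](_ : _ = 1 + (t + 1)); last by lia.
  rewrite iterD [iter (t + 1) _ _]iterD /=.
  have /= E := nthE _ _ _ 0 def_c isT; rewrite addn0 in E.
  move: def_c E => /=; do 3![rewrite -?catA /=].
  set p0 := (size pre).+1; set pf := (p0 + _).+1; set pt := (pf + _).+1.
  set e := (pt + _).+1 => def_c E.
  have eE : size pre + (code_size c0 + code_size cf + code_size ct).+4 = e.
    by rewrite /e /pt /pf /p0; lia.
  have cP1 : at_point (if s v is b :: _ then if b then pt else pf else p0) s (step c).
    by apply: (step_jump _ E wv) cP; rewrite /pt /pf /p0; lia.
  have fin pre' l post' : code = pre' ++ goto e :: post' -> size pre' = l ->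
      forall c', at_point l s' c' -> at_point e s' (step c').
    move=> def' <- c'; apply: step_goto; rewrite ?def' ?nth_cat ?ltnn ?subnn //.
      by rewrite size_cat /=; lia.
    by rewrite -def'; lia.
  rewrite eE.
  case: (s v) IH cP1 => [|[] _] IH cP1.
  + have := IH w0 (rcons pre (IJump v p0 pf pt)) (goto e ::
      compile pf cf ++ goto e :: compile pt ct ++ goto e :: post) (step c).
    rewrite size_rcons -/p0 cat_rcons => step1.
    apply: (fin (pre ++ IJump v p0 pf pt :: compile p0 c0) _
      (compile pf cf ++ goto e :: compile pt ct ++ goto e :: post));
      last exact: step1 def_c cP1.
    * by rewrite def_c; do 4![rewrite -?catA /=].
    * by rewrite size_cat /= size_compile /p0; lia.
  + have := IH wt (pre ++ IJump v p0 pf pt :: compile p0 c0 ++ goto e ::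
      compile pf cf ++ [:: goto e]) (goto e :: post) (step c).
    rewrite size_cat /= size_cat /= size_cat !size_compile /=.
    rewrite [size pre + _](_ : _ = pt); last by rewrite /pt /pf /p0; lia.
    move=> step1.
    apply: (fin (pre ++ IJump v p0 pf pt :: compile p0 c0 ++ goto e ::
      compile pf cf ++ goto e :: compile pt ct) _ post); last apply: step1 _ cP1.
    * by rewrite def_c; do 4![rewrite -?catA /=].
    * rewrite size_cat /= size_cat /= size_cat /= !size_compile.
      by rewrite /pt /pf /p0; lia.
    * by rewrite def_c; do 4![rewrite -?catA /=].
  + have := IH wf (pre ++ IJump v p0 pf pt :: compile p0 c0 ++ [:: goto e])
      (goto e :: compile pt ct ++ goto e :: post) (step c).
    rewrite size_cat /= size_cat /= !size_compile /=.
    rewrite [size pre + _](_ : _ = pf); last by rewrite /pf /p0; lia.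
    move=> step1.
    apply: (fin (pre ++ IJump v p0 pf pt :: compile p0 c0 ++ goto e ::
      compile pf cf) _ (compile pt ct ++ goto e :: post)); last apply: step1 _ cP1.
    * by rewrite def_c; do 4![rewrite -?catA /=].
    * rewrite size_cat /= size_cat /= !size_compile.
      by rewrite /pt /pf /p0; lia.
    * by rewrite def_c; do 4![rewrite -?catA /=].
- move=> v cm s sv0; rewrite geq_max => /andP[wv w] pre post c def_c cP.
  have sz := sizeE _ _ _ def_c; rewrite size_compile /= in sz.
  have /= E := nthE _ _ _ 0 def_c isT; rewrite addn0 in E.
  have /= := step_jump _ E wv _ _ _ cP; rewrite sv0 /=.
  rewrite (_ : (size pre).+1 + _ = size pre + (code_size cm).+1) -?addnS; last lia.
  by apply; lia.
- move=> v cm t1 t2 s s1 s2 svN _ IH1 _ IH2; rewrite geq_max => /andP[wv w].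
  move=> pre post c def_c cP.
  have sz := sizeE _ _ _ def_c; rewrite size_compile /= in sz.
  (* Read from the right: test, body, jump back, and then the remaining rounds, which start again at
     the address of the same loop. *)
  rewrite [_.+2](_ : _ = t2 + (1 + (t1 + 1))); last by lia.
  rewrite iterD; apply: IH2 (def_c) _; first by rewrite geq_max wv.
  have /= E := nthE _ _ _ 0 def_c isT; rewrite addn0 in E.
  have /= := step_jump _ E wv _ _ _ cP; set a := if _ is _ :: _ then _ else _.
  have -> : a = (size pre).+1 by rewrite /a; case: (s v) svN => // [[]].
  move=> cP1; have {cP1} : at_point (size pre).+1 s (step c) by apply: cP1; lia.
  rewrite iterD [iter (t1 + 1) _ _]iterD /=.
  have := IH1 w (rcons pre (IJump v ((size pre).+1 + code_size cm).+1
    (size pre).+1 (size pre).+1)) (goto (size pre) :: post) (step c).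
  rewrite size_rcons cat_rcons def_c /= -!catA /= => /(_ erefl) H /H.
  apply: step_goto; try lia.
  have /= := nthE _ _ _ (code_size cm).+1 def_c; rewrite addSnnS => ->.
    by rewrite nth_cat size_compile ltnn subnn.
  by rewrite size_cat size_compile /=; lia.
Qed.

End Compilation.

Theorem exec_poly_time (cm : cmd) (f : seq bool -> seq bool) (p : {poly nat}) :
  (forall x, exists t s', [/\ exec cm t (upd (fun=> [::]) 0 x) s',
     t <= p.[size x]%R & s' 0 = f x]) ->
  poly_time_computable f.
Proof.
move=> execP; exists (code_machine (cmd_width cm) (compile 0 cm)), p => x.
have [t [s' [ex le_t <-]]] := execP x.
set M := code_machine _ _.
have cP : at_point 0 (upd (fun=> [::]) 0 x) (initial M x).
  split=> // i; rewrite ffunE /upd -val_eqE /=; exists 0.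
  by case: eqP; rewrite cats0.
have [] := compile_correct ex (leqnn _) (pre := [::]) (post := [::]) _ cP.
  by rewrite cats0.
rewrite add0n => halt /(_ ord0) [j out].
(* A halting configuration does not change, so the run can be prolonged from [t] steps to the value
   of the polynomial. *)
have fixed n (c : config M) : c.1 = code_size cm :> nat -> iter n (@step M) c = c.
  move=> hc; elim: n => //= n ->; case: c hc => q ts /= hc.
  rewrite /step; case: ifP => // /negP[]; apply/eqP.
  exact: etrans hc (esym (size_compile 0 cm)).
rewrite /outputs_within -(subnK le_t) iterD fixed //; split.
  by apply/eqP; exact: etrans halt (esym (size_compile 0 cm)).
by rewrite out; elim: (s' 0) => [|b w /= ->] //=; case: (j).
Qed.

(** * Polynomial running times *)

Definition poly_bounded (f : nat -> nat) :=
  exists p : {poly nat}, forall b, f b <= p.[b]%R.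

(** Natural coefficients make polynomials monotone. This gives closure under composition, and lets
    one time bound serve all shorter words. *)
Lemma leq_horner (p : {poly nat}) x y : x <= y -> p.[x]%R <= p.[y]%R.
Proof.
move=> le_xy; rewrite !horner_coef; apply: leq_sum => i _.
have powE z : (z ^+ i)%R = z ^ i.
  by elim: (i : nat) => // j IH; rewrite exprS IH expnS.
rewrite !powE; apply: (@leq_mul (p`_i)%R); first exact: leqnn.
by elim: (i : nat) => // j IH; rewrite !expnS leq_mul.
Qed.

Lemma poly_bounded_cst n : poly_bounded (fun=> n).
Proof. by exists (n%:P)%R => b; rewrite hornerC. Qed.

Lemma poly_bounded_id : poly_bounded id.
Proof. by exists 'X%R => b; rewrite hornerX. Qed.

Lemma poly_bounded_add f g :
  poly_bounded f -> poly_bounded g -> poly_bounded (fun b => f b + g b).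
Proof.
by move=> [p fP] [q gP]; exists (p + q)%R => b; rewrite hornerD leq_add.
Qed.

Lemma poly_bounded_mul f g :
  poly_bounded f -> poly_bounded g -> poly_bounded (fun b => f b * g b).
Proof.
by move=> [p fP] [q gP]; exists (p * q)%R => b; rewrite hornerM leq_mul.
Qed.

Lemma poly_bounded_comp f g :
  poly_bounded f -> poly_bounded g -> poly_bounded (fun b => f (g b)).
Proof.
move=> [p fP] [q gP]; exists (p \Po q)%R => b; rewrite horner_comp.
exact: leq_trans (fP _) (leq_horner _ (gP _)).
Qed.

Ltac pbound := repeat first
  [ apply: poly_bounded_add | apply: poly_bounded_mul | apply: poly_bounded_id
  | apply: poly_bounded_cst | assumption
  | match goal with H : poly_bounded ?f |- poly_bounded (fun x => ?f (@?g x)) =>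
      apply: (@poly_bounded_comp f g H) end ].

(** An upper bound replaces the exact time, since the rounds of a loop and the branches of a test
    differ in length. *)
Definition run c T s s' := exists2 t, t <= T & exec c t s s'.

Lemma run_le c T T' s s' : T <= T' -> run c T s s' -> run c T' s s'.
Proof. by move=> le_T [t le_t ex]; exists t => //; apply: leq_trans le_T. Qed.

Lemma run_skip s : run Skip 0 s s.
Proof. by exists 0 => //; constructor. Qed.

Lemma run_push v b s : run (Push v b) 2 s (upd s v (b :: s v)).
Proof. by exists 2 => //; constructor. Qed.

Lemma run_pop v s : run (Pop v) 1 s (upd s v (behead (s v))).
Proof. by exists 1 => //; constructor. Qed.

Lemma run_seq c1 c2 T1 T2 s s1 s2 :
  run c1 T1 s s1 -> run c2 T2 s1 s2 -> run (Seq c1 c2) (T1 + T2) s s2.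
Proof.
move=> [t1 le1 ex1] [t2 le2 ex2]; exists (t1 + t2); first exact: leq_add.
exact: ExecSeq ex1 ex2.
Qed.

Lemma run_case v c0 cf ct T s s' :
  run (if s v is b :: _ then if b then ct else cf else c0) T s s' ->
  run (Case v c0 cf ct) T.+2 s s'.
Proof. by case=> t le_t ex; exists t.+2 => //; constructor. Qed.

Lemma run_while v c T n (I : nat -> store) :
  (forall i, i < n -> I i v != [::] /\ run c T (I i) (I i.+1)) ->
  I n v = [::] -> run (While v c) (n * T.+2 + 1) (I 0) (I n).
Proof.
elim: n I => [|n IH] I stepI endI.
  by exists 1 => //; constructor.
have [I0 [t1 le1 ex1]] := stepI 0 isT.
have [|t2 le2 ex2] := IH (fun i => I i.+1) _ endI; first by move=> i lt_i; apply: (stepI i.+1).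
by exists (t1 + t2).+2; [rewrite mulSn; lia | apply: ExecWhileCons ex1 ex2].
Qed.

Lemma run_eq c T s s1 s2 : run c T s s1 -> s1 =1 s2 -> run c T s s2.
Proof. by move=> r e; rewrite -(functional_extensionality _ _ e). Qed.

Lemma upd_same s v w : upd s v w v = w.
Proof. by rewrite /upd eqxx. Qed.

Lemma upd_other s v w u : u != v -> upd s v w u = s u.
Proof. by rewrite /upd => /negPf ->. Qed.

Ltac updE := rewrite /upd; repeat match goal with
  |- context [ if ?a == ?b then _ else _ ] => case: (eqVneq a b) end.

Lemma catrev_take (T : eqType) (x0 : T) i (s r : seq T) : i < size s ->
  catrev (take i.+1 s) r = nth x0 s i :: catrev (take i s) r.
Proof.
by move=> lt_i; rewrite (take_nth x0) // !catrevE rev_rcons cat_cons.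
Qed.

(** * Basic stack routines *)

Definition transfer v w (c : cmd) :=
  While v (Case v Skip
    (Seq (Pop v) (Seq (Push w false) c)) (Seq (Pop v) (Seq (Push w true) c))).

Lemma run_transfer (v w : nat) (s : store) : v != w ->
  run (transfer v w Skip) (size (s v) * 7 + 1) s
    (upd (upd s v [::]) w (catrev (s v) (s w))).
Proof.
move=> vw.
pose I i := upd (upd s v (drop i (s v))) w (catrev (take i (s v)) (s w)).
have E : s = I 0.
  apply: functional_extensionality => u; rewrite /I drop0 take0 /=.
  by updE => // ->.
rewrite {2}E.
have -> : upd (upd s v [::]) w (catrev (s v) (s w)) = I (size (s v)).
  by rewrite /I drop_size take_size.
apply: (@run_while v _ 5) => [i lt_i|]; last first.
  by rewrite /I drop_size /upd (negPf vw) eqxx.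
have Iv : I i v = nth true (s v) i :: drop i.+1 (s v).
  by rewrite /I /upd (negPf vw) eqxx (drop_nth true).
split; first by rewrite Iv.
apply: (run_case (T := 3)).
have -> : (if I i v is b :: _ then if b then
      Seq (Pop v) (Seq (Push w true) Skip) else Seq (Pop v) (Seq (Push w false) Skip) else Skip)
  = Seq (Pop v) (Seq (Push w (nth true (s v) i)) Skip).
  by rewrite Iv; case: (nth _ _ _).
apply: (@run_le _ (1 + (2 + 0))) => //.
apply: (run_seq (run_pop _ _)); apply: run_seq (run_push _ _ _) _.
apply: run_eq (run_skip _) _ => u; rewrite Iv /=.
rewrite /I (catrev_take true) // /upd eqxx [w == v]eq_sym (negPf vw).
by case: (u == w); case: (u == v).
Qed.

Lemma run_restore (v w a : nat) (s : store) : v != w -> a != v -> a != w ->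
  run (transfer v w (Push a true)) (size (s v) * 9 + 1) s
    (upd (upd (upd s v [::]) w (catrev (s v) (s w)))
       a (nseq (size (s v)) true ++ s a)).
Proof.
move=> vw av aw.
pose I i := upd (upd (upd s v (drop i (s v))) w (catrev (take i (s v)) (s w)))
  a (nseq i true ++ s a).
have E : s = I 0.
  apply: functional_extensionality => u; rewrite /I drop0 take0 /=.
  by updE => // ->.
have wv : w != v by rewrite eq_sym.
have va : v != a by rewrite eq_sym.
have wa : w != a by rewrite eq_sym.
have nE := (negPf vw, negPf av, negPf aw, negPf wv, negPf va, negPf wa, eqxx).
rewrite {2}E.
have -> : upd (upd (upd s v [::]) w (catrev (s v) (s w)))
       a (nseq (size (s v)) true ++ s a) = I (size (s v)).
  by rewrite /I drop_size take_size.
apply: (@run_while v _ 7) => [i lt_i|]; last by rewrite /I drop_size /upd !nE.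
have Iv : I i v = nth true (s v) i :: drop i.+1 (s v).
  by rewrite /I /upd !nE (drop_nth true).
split; first by rewrite Iv.
apply: (run_case (T := 5)).
have -> : (if I i v is b :: _ then if b then
      Seq (Pop v) (Seq (Push w true) (Push a true)) else
      Seq (Pop v) (Seq (Push w false) (Push a true)) else Skip)
  = Seq (Pop v) (Seq (Push w (nth true (s v) i)) (Push a true)).
  by rewrite Iv; case: (nth _ _ _).
apply: (@run_le _ (1 + (2 + 2))) => //.
apply: (run_seq (run_pop _ _)); apply: run_seq (run_push _ _ _) _.
apply: run_eq (run_push _ _ _) _ => u; rewrite Iv /=.
rewrite /I (catrev_take true) // /upd !nE.
by case: (u == a); case: (u == w); case: (u == v).
Qed.

(** A stack can be read only by emptying it. Its bits go to the scratch stack [d] in reverse order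
    and come back in the original order, each one leaving a mark on [a] on the way back. *)
Definition add_size v a d :=
  Seq (transfer v d Skip) (transfer d v (Push a true)).

Lemma run_add_size (v a d : nat) (s : store) : v != d -> a != v -> a != d -> s d = [::] ->
  run (add_size v a d) (size (s v) * 16 + 2) s
    (upd s a (nseq (size (s v)) true ++ s a)).
Proof.
move=> vd av ad sd; apply: (@run_le _ ((size (s v) * 7 + 1) + (size (s v) * 9 + 1))).
  by lia.
apply: run_seq (run_transfer _ vd) _.
have dv : d != v by rewrite eq_sym.
have := @run_restore d v a (upd (upd s v [::]) d (catrev (s v) (s d))) dv ad av.
rewrite upd_same sd catrevE cats0 size_rev => r; apply: run_eq r _ => u.
rewrite [upd _ _ _ v]upd_other // upd_same ![upd _ _ _ a]upd_other //.
rewrite catrevE revK cats0.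
by updE => // -> //; rewrite sd.
Qed.

Definition clear v := While v (Pop v).

Lemma run_clear v s : run (clear v) (size (s v) * 3 + 1) s (upd s v [::]).
Proof.
pose I i := upd s v (drop i (s v)).
have {2}-> : s = I 0.
  by apply: functional_extensionality => u; rewrite /I drop0; updE => // ->.
have -> : upd s v [::] = I (size (s v)) by rewrite /I drop_size.
apply: (@run_while v _ 1) => [i lt_i|]; last by rewrite /I drop_size upd_same.
rewrite /I upd_same (drop_nth true) //; split=> //.
apply: run_eq (run_pop _ _) _ => u; rewrite upd_same /=; by updE.
Qed.

(** * Formulas of bounded arithmetic *)

Inductive term :=
| TVar (i : nat)
| TSize
| TCst (n : nat)
| TAdd (t1 t2 : term)
| TMul (t1 t2 : term).

Fixpoint teval (t : term) (x : seq bool) (env : seq nat) : nat :=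
  match t with
  | TVar i => nth 0 env i
  | TSize => size x
  | TCst n => n
  | TAdd t1 t2 => teval t1 x env + teval t2 x env
  | TMul t1 t2 => teval t1 x env * teval t2 x env
  end.

(** One connective and one quantifier keep the compiler to four cases; the others are derived.
    Variables are de Bruijn indices, and [FEx] ranges over the numbers below its term. *)
Inductive formula :=
| FLe (t1 t2 : term)
| FBit (t : term)
| FNand (f1 f2 : formula)
| FEx (t : term) (f : formula).

Fixpoint sat (f : formula) (x : seq bool) (env : seq nat) : bool :=
  match f with
  | FLe t1 t2 => teval t1 x env <= teval t2 x env
  | FBit t => nth false x (teval t x env)
  | FNand f1 f2 => ~~ (sat f1 x env && sat f2 x env)
  | FEx t f1 => has (fun i => sat f1 x (i :: env)) (iota 0 (teval t x env))
  end.

(* The tapes from [d] on are free; [r] lists the tapes of the variables, whose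
   values are the heights of these stacks; the value is added to tape [a]. *)
Fixpoint tcomp (t : term) (r : seq nat) (a d : nat) : cmd :=
  match t with
  | TVar i => if i < size r then add_size (nth 0 r i) a d else Skip
  | TSize => add_size 0 a d
  | TCst n => iter n (Seq (Push a true)) Skip
  | TAdd t1 t2 => Seq (tcomp t1 r a d) (tcomp t2 r a d)
  | TMul t1 t2 =>
      Seq (tcomp t1 r d d.+1) (While d (Seq (Pop d) (tcomp t2 r a d.+1)))
  end.

Definition free_from d (s : store) := forall v, d <= v -> s v = [::].

(** The target [a] differs from stack 0, which holds the input, and from the stacks of the
    variables, so that adding to it changes neither the word nor the environment. *)
Definition regs_ok (r : seq nat) a d :=
  [&& 0 < a, a < d & all (fun v => (v < d) && (v != a)) r].

Definition env_of (r : seq nat) (s : store) : seq nat := [seq size (s v) | v <- r].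

Definition bounded b (x : seq bool) (env : seq nat) :=
  (size x <= b) && all (leq^~ b) env.

Lemma regs_okS r a d : regs_ok r a d -> regs_ok r d d.+1.
Proof.
case/and3P=> a0 ad rP; apply/and3P; split; rewrite ?(leq_ltn_trans _ ad) //.
by apply: sub_all rP => v /andP[vd _]; rewrite ltnW //= ltn_eqF.
Qed.

Lemma regs_ok_weak r a d d' : d <= d' -> regs_ok r a d -> regs_ok r a d'.
Proof.
move=> le_d /and3P[a0 ad rP]; apply/and3P; split; rewrite ?(leq_trans ad) //.
by apply: sub_all rP => v /andP[vd ->]; rewrite (leq_trans vd).
Qed.

Lemma free_from_upd d d' v w s :
  free_from d s -> d <= d' -> v < d' -> free_from d' (upd s v w).
Proof.
by move=> fs le_d lt_v u le_u; rewrite upd_other ?fs //; [lia | apply/eqP; lia].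
Qed.

Lemma env_of_upd r a d s w : regs_ok r a d -> env_of r (upd s a w) = env_of r s.
Proof.
case/and3P=> _ _ rP; apply/eq_in_map => v v_r; rewrite upd_other //.
by have /andP[] := allP rP v v_r.
Qed.

Lemma upd_upd s v w w' : upd (upd s v w) v w' = upd s v w'.
Proof. by apply: functional_extensionality => u; updE. Qed.

Lemma upd_comm s v v' w w' : v != v' ->
  upd (upd s v w) v' w' = upd (upd s v' w') v w.
Proof.
by move=> vv'; apply: functional_extensionality => u; updE => // -> E;
  rewrite E eqxx in vv'.
Qed.

Lemma upd_id s v w : s v = w -> upd s v w = s.
Proof. by move=> E; apply: functional_extensionality => u; updE => // ->. Qed.

(** Values of terms count the rounds of loops and bound the quantified variables; both therefore
    stay polynomial in the size of the input. *)
Lemma leq_teval t : exists2 V, poly_bounded V &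
  forall b x env, bounded b x env -> teval t x env <= V b.
Proof.
elim: t => [i||n|t1 [V1 V1P IH1] t2 [V2 V2P IH2]|t1 [V1 V1P IH1] t2 [V2 V2P IH2]].
- exists id; first by pbound.
  move=> b x env /andP[_ /allP envP] /=; case: (ltnP i (size env)) => lt_i.
    by apply: envP; apply: mem_nth.
  by rewrite nth_default.
- by exists id; [pbound | move=> b x env /andP[]].
- by exists (fun=> n); first by pbound.
- exists (fun b => V1 b + V2 b); first by pbound.
  by move=> b x env bP; apply: leq_add; [apply: IH1 | apply: IH2].
- exists (fun b => V1 b * V2 b); first by pbound.
  by move=> b x env bP; apply: leq_mul; [apply: IH1 | apply: IH2].
Qed.

Lemma nseq_cat_add (T : Type) m n (x : T) s :
  nseq (m + n) x ++ s = nseq m x ++ nseq n x ++ s.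
Proof. by rewrite nseqD catA. Qed.

Lemma run_tcomp t : exists2 T, poly_bounded T &
  forall r a d s b, regs_ok r a d -> free_from d s -> bounded b (s 0) (env_of r s) ->
  run (tcomp t r a d) (T b) s
    (upd s a (nseq (teval t (s 0) (env_of r s)) true ++ s a)).
Proof.
elim: t => [i||n|t1 [T1 T1P IH1] t2 [T2 T2P IH2]|t1 [T1 T1P IH1] t2 [T2 T2P IH2]].
- exists (fun b => b * 16 + 2); first by pbound.
  move=> r a d s b rP fs bP /=; case: ifP => lt_i; last first.
    rewrite nth_default ?size_map 1?leqNgt ?lt_i //= upd_id //.
    exact: run_le (run_skip s).
  case/and3P: rP => a0 ad /allP /(_ _ (mem_nth 0 lt_i)) /andP[vd va].
  rewrite (nth_map 0) //.
  apply: run_le (run_add_size _ _ _ (fs d (leqnn d))) => //.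
  + rewrite leq_add2r leq_mul2r /=; case/andP: bP => _ /allP; apply.
    by apply/mapP; exists (nth 0 r i) => //; apply: mem_nth.
  + by rewrite ltn_eqF.
  + by rewrite eq_sym.
  + by rewrite ltn_eqF.
- exists (fun b => b * 16 + 2); first by pbound.
  move=> r a d s b /and3P[a0 ad rP] fs /andP[bx _] /=.
  apply: run_le (run_add_size _ _ _ (fs d (leqnn d))) => //.
  + by rewrite leq_add2r leq_mul2r /=.
  + by rewrite ltn_eqF //; lia.
  + by rewrite -lt0n.
  + by rewrite ltn_eqF.
- exists (fun b => 2 * n); first by pbound.
  move=> r a d s b _ _ _ /=; elim: n s => [|n IH] s.
    by rewrite upd_id //; apply: run_skip.
  rewrite mulnS; apply: run_seq (run_push _ _ _) _.
  have := IH (upd s a (true :: s a)); rewrite upd_upd upd_same.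
  suff -> l : nseq n true ++ true :: l = true :: nseq n true ++ l by [].
  by rewrite -[_ :: l]/(nseq 1 true ++ l) -nseq_cat_add addn1.
- exists (fun b => T1 b + T2 b); first by pbound.
  move=> r a d s b rP fs bP /=.
  have /and3P[a0 ad _] := rP.
  apply: (run_seq (IH1 _ _ _ _ _ rP fs bP)).
  have := IH2 _ _ _ (upd s a (nseq (teval t1 (s 0) (env_of r s)) true ++ s a)) b rP.
  rewrite (env_of_upd _ _ rP) upd_upd upd_same upd_other ?ltn_eqF //.
  rewrite addnC nseq_cat_add; apply=> //.
  exact: free_from_upd fs _ _.
- have [V VP leV] := leq_teval t1.
  exists (fun b => T1 b + (V b * (1 + T2 b + 2) + 1)); first by pbound.
  move=> r a d s b rP fs bP /=.
  have /and3P[a0 ad _] := rP.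
  have rP' := regs_okS rP.
  have fs' : free_from d.+1 s by move=> v /ltnW; apply: fs.
  apply: (run_seq (IH1 _ _ _ _ _ rP' fs' bP)).
  rewrite (fs d (leqnn d)) cats0.
  have := leV _ _ _ bP; set n := teval t1 _ _; set k := teval t2 _ _ => le_n.
  have da : d != a by rewrite gtn_eqF.
  have ad' : a != d by rewrite eq_sym.
  pose I i := upd (upd s d (nseq (n - i) true)) a (nseq (i * k) true ++ s a).
  apply: (@run_le _ (n * (1 + T2 b).+2 + 1)).
    by rewrite leq_add2r leq_mul //; lia.
  have -> : upd s d (nseq n true) = I 0.
    by rewrite /I subn0 mul0n /= [RHS]upd_id // upd_other.
  have -> : upd s a (nseq (n * k) true ++ s a) = I n.
    rewrite /I subnn /= (@upd_id s d) //; exact: fs.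
  apply: run_while => [i lt_i|]; last by rewrite /I subnn upd_other // upd_same.
  have Id : I i d = true :: nseq (n - i.+1) true.
    by rewrite /I upd_other // upd_same -(subnSK lt_i).
  rewrite Id; split=> //; apply: run_seq (run_pop _ _) _; rewrite Id /=.
  have -> : upd (I i) d (nseq (n - i.+1) true) =
      upd (upd s d (nseq (n - i.+1) true)) a (nseq (i * k) true ++ s a).
    by rewrite /I upd_comm // upd_upd.
  set s1 := upd _ a _.
  have E : env_of r s1 = env_of r s by rewrite (env_of_upd _ _ rP) (env_of_upd _ _ rP').
  have E0 : s1 0 = s 0 by rewrite /s1 !upd_other // ltn_eqF //; lia.
  have := IH2 r a d.+1 s1 b.
  have Ea : s1 a = nseq (i * k) true ++ s a by rewrite /s1 upd_same.
  rewrite E E0 -/k Ea -nseq_cat_add -mulSn.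
  have -> : upd s1 a (nseq (i.+1 * k) true ++ s a) = I i.+1.
    by rewrite /s1 upd_upd.
  apply=> //.
    exact: regs_ok_weak rP.
  apply: (@free_from_upd d.+1) => //; last by lia.
  exact: free_from_upd fs' _ _.
Qed.

(** A comparison is a truncated subtraction followed by a test for emptiness. A bit of the input is
    exposed by moving the bits above it to a scratch stack. In a quantifier, the loop counter on [d]
    is itself the bound variable, [d.+2] receives the truth value, and [d.+1] gets one mark per
    witness. *)
Fixpoint fcomp (f : formula) (r : seq nat) (a d : nat) : cmd :=
  match f with
  | FLe t1 t2 =>
      Seq (tcomp t1 r d d.+2) (Seq (tcomp t2 r d.+1 d.+2)
      (Seq (While d.+1 (Seq (Pop d.+1) (Pop d)))
      (Seq (Case d (Push a true) (Push a false) (Push a false)) (clear d))))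
  | FBit t =>
      let shift b := Seq (Push d.+1 b) (Pop 0) in
      Seq (tcomp t r d d.+2)
      (Seq (While d (Seq (Pop d) (Case 0 Skip (shift false) (shift true))))
      (Seq (Case 0 (Push a false) (Push a false) (Push a true))
      (transfer d.+1 0 Skip)))
  | FNand f1 f2 =>
      Seq (fcomp f1 r d d.+2) (Seq (fcomp f2 r d.+1 d.+2)
      (Seq (Case d Skip (Push a true)
              (Case d.+1 Skip (Push a true) (Push a false)))
      (Seq (Pop d) (Pop d.+1))))
  | FEx t f1 =>
      Seq (tcomp t r d d.+3)
      (Seq (While d (Seq (Pop d) (Seq (fcomp f1 (d :: r) d.+2 d.+3)
         (Seq (Case d.+2 Skip Skip (Push d.+1 true)) (Pop d.+2)))))
      (Seq (Case d.+1 (Push a false) (Push a true) (Push a true))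
      (clear d.+1)))
  end.

Lemma env_of_upd_free r a d s v w : regs_ok r a d -> d <= v ->
  env_of r (upd s v w) = env_of r s.
Proof.
case/and3P=> _ _ rP le_d; apply/eq_in_map => u u_r; rewrite upd_other //.
by have /andP[lt_u _] := allP rP u u_r; apply/eqP; lia.
Qed.

Lemma regs_ok_cons r a d : regs_ok r a d -> regs_ok (d :: r) d.+2 d.+3.
Proof.
case/and3P=> a0 ad rP; apply/and3P; split=> //=; apply/andP; split.
  by apply/andP; split; [lia | apply/eqP; lia].
apply: sub_all rP => v /andP[vd _].
by apply/andP; split; [lia | apply/eqP; lia].
Qed.

Lemma free_from_weak d d' s : d <= d' -> free_from d s -> free_from d' s.
Proof. by move=> le_d fs v le_v; apply: fs; apply: leq_trans le_v. Qed.

Ltac store_eq := updE => *; subst; first [by [] | congruence | lia].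

Lemma run_fcomp f : exists2 T, poly_bounded T &
  forall r a d s b, regs_ok r a d -> free_from d s -> bounded b (s 0) (env_of r s) ->
  run (fcomp f r a d) (T b) s (upd s a (sat f (s 0) (env_of r s) :: s a)).
Proof.
elim: f => [t1 t2|t|f1 [T1 T1P IH1] f2 [T2 T2P IH2]|t f1 [T1 T1P IH1]].
- have [T1 T1P IH1] := run_tcomp t1; have [T2 T2P IH2] := run_tcomp t2.
  have [V1 V1P leV1] := leq_teval t1; have [V2 V2P leV2] := leq_teval t2.
  exists (fun b => T1 b + (T2 b + ((V2 b * 4 + 1) + (4 + (V1 b * 3 + 1)))));
    first by pbound.
  move=> r a d s b rP fs bP /=; have /and3P[a0 ad _] := rP.
  have rP1 := regs_okS rP; have rP2 := regs_okS rP1.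
  have fs2 : free_from d.+2 s by apply: free_from_weak fs; lia.
  have sd : s d = [::] by apply: fs.
  have sd1 : s d.+1 = [::] by apply: fs.
  have := leV1 _ _ _ bP; have := leV2 _ _ _ bP.
  set m := teval t1 _ _; set n := teval t2 _ _ => le_n le_m.
  apply: (@run_seq _ _ _ _ _ (upd s d (nseq m true))).
    have := IH1 r d d.+2 s b (regs_ok_weak (leqnSn _) rP1) fs2 bP.
    by rewrite sd cats0.
  set s1 := upd s d _.
  have E1 : env_of r s1 = env_of r s by apply: env_of_upd_free rP _.
  have E10 : s1 0 = s 0 by rewrite /s1 upd_other //; apply/eqP; lia.
  apply: (@run_seq _ _ _ _ _ (upd s1 d.+1 (nseq n true))).
    have := IH2 r d.+1 d.+2 s1 b rP2; rewrite E1 E10.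
    rewrite [s1 d.+1](_ : _ = [::]) ?cats0; last first.
      by rewrite /s1 upd_other //; apply/eqP; lia.
    by apply=> //; apply: free_from_upd fs _ _; lia.
  pose I i := upd (upd s d (nseq (m - i) true)) d.+1 (nseq (n - i) true).
  apply: (@run_seq _ _ _ _ _ (I n)).
    have -> : upd s1 d.+1 (nseq n true) = I 0 by rewrite /I !subn0.
    apply: (@run_le _ (n * 4 + 1)); first by rewrite leq_add2r leq_mul2r.
    apply: (@run_while _ _ 2) => [i lt_i|]; last by rewrite /I upd_same subnn.
    have Id : I i d.+1 = true :: nseq (n - i.+1) true.
      by rewrite /I upd_same -(subnSK lt_i).
    rewrite Id; split=> //.
    apply: (@run_le _ (1 + 1)) => //; apply: run_seq (run_pop _ _) _.
    apply: run_eq (run_pop _ _) _ => u; rewrite Id /=.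
    have -> : upd (I i) d.+1 (nseq (n - i.+1) true) =
        upd (upd s d (nseq (m - i) true)) d.+1 (nseq (n - i.+1) true).
      by rewrite /I upd_upd.
    rewrite [X in behead X]upd_other ?upd_same; last by apply/eqP; lia.
    have -> : behead (nseq (m - i) true) = nseq (m - i.+1) true.
      by rewrite subnS; case: (m - i).
    rewrite /I; store_eq.
  apply: (@run_seq _ _ _ _ _ (upd (I n) a ((m <= n) :: s a))).
    apply: (run_case (T := 2)).
    have -> : I n d = nseq (m - n) true.
      by rewrite /I upd_other ?upd_same //; apply/eqP; lia.
    have Ia : I n a = s a by rewrite /I !upd_other //; apply/eqP; lia.
    rewrite -subn_eq0 -Ia; case: (m - n) => [|j] /=; exact: run_push.
  apply: (@run_le _ (size (upd (I n) a ((m <= n) :: s a) d) * 3 + 1)).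
    rewrite upd_other; last by apply/eqP; lia.
    rewrite /I upd_other ?upd_same ?size_nseq; last by apply/eqP; lia.
    by rewrite leq_add2r leq_mul2r; lia.
  apply: run_eq (run_clear _ _) _ => u.
  rewrite /I subnn; store_eq.
- have [T TP IH] := run_tcomp t; have [V VP leV] := leq_teval t.
  exists (fun b => T b + ((V b * 8 + 1) + (4 + (b * 7 + 1)))); first by pbound.
  move=> r a d s b rP fs bP /=; have /and3P[a0 ad _] := rP.
  have rP1 := regs_okS rP.
  have fs2 : free_from d.+2 s by apply: free_from_weak fs; lia.
  have sd : s d = [::] by apply: fs.
  have sd1 : s d.+1 = [::] by apply: fs.
  have := leV _ _ _ bP; set n := teval t _ _ => le_n.
  apply: (@run_seq _ _ _ _ _ (upd s d (nseq n true))).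
    have := IH r d d.+2 s b (regs_ok_weak (leqnSn _) rP1) fs2 bP.
    by rewrite sd cats0.
  pose I i := upd (upd (upd s d (nseq (n - i) true)) d.+1 (rev (take i (s 0))))
    0 (drop i (s 0)).
  have d0 : d != 0 by apply/eqP; lia.
  apply: (@run_seq _ _ _ _ _ (I n)).
    have -> : upd s d (nseq n true) = I 0.
      apply: functional_extensionality => u.
      by rewrite /I subn0 take0 drop0; store_eq.
    apply: (@run_le _ (n * 8 + 1)); first by rewrite leq_add2r leq_mul2r.
    apply: (@run_while _ _ 6) => [i lt_i|].
      have Id : I i d = true :: nseq (n - i.+1) true.
        rewrite /I upd_other // upd_other ?upd_same -?(subnSK lt_i) //.
        by apply/eqP; lia.
      rewrite Id; split=> //.
      apply: (@run_le _ (1 + 5)) => //; apply: run_seq (run_pop _ _) _.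
      rewrite Id /=; apply: run_case.
      rewrite upd_other 1?eq_sym // {1}/I upd_same.
      case: (ltnP i (size (s 0))) => le_i; last first.
        rewrite drop_oversize //; apply: (@run_le _ 0) => //.
        apply: run_eq (run_skip _) _ => u; rewrite /I.
        rewrite !take_oversize ?drop_oversize ?(leqW le_i) //; store_eq.
      rewrite (drop_nth false le_i).
      have -> (x : bool) : (if x then Seq (Push d.+1 true) (Pop 0) else
        Seq (Push d.+1 false) (Pop 0)) = Seq (Push d.+1 x) (Pop 0) by case: x.
      apply: (@run_le _ (2 + 1)) => //; apply: run_seq (run_push _ _ _) _.
      apply: run_eq (run_pop _ _) _ => u; rewrite /I.
      rewrite (take_nth false) // rev_rcons (drop_nth false le_i).
      store_eq.
    by rewrite /I upd_other // upd_other ?upd_same ?subnn //; apply/eqP; lia.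
  apply: (@run_seq _ _ _ _ _ (upd (I n) a (nth false (s 0) n :: s a))).
    apply: (run_case (T := 2)).
    have Ia : I n a = s a by rewrite /I !upd_other //; apply/eqP; lia.
    rewrite {1}/I upd_same -Ia; case: (ltnP n (size (s 0))) => le_s.
      by rewrite (drop_nth false) //; case: (nth _ _ _); apply: run_push.
    by rewrite drop_oversize // nth_default //; apply: run_push.
  have I0 : upd (I n) a (nth false (s 0) n :: s a) 0 = drop n (s 0).
    by rewrite upd_other ?upd_same //; apply/eqP; lia.
  have Id : upd (I n) a (nth false (s 0) n :: s a) d.+1 = rev (take n (s 0)).
    rewrite upd_other; last by apply/eqP; lia.
    by rewrite /I upd_other ?upd_same.
  apply: (@run_le _ (size (upd (I n) a (nth false (s 0) n :: s a) d.+1) * 7 + 1)).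
    rewrite Id size_rev leq_add2r leq_mul2r /=.
    by case/andP: bP => bx _; rewrite size_take; case: ifP; lia.
  apply: run_eq (run_transfer _ _) _ => // u.
  rewrite I0 Id catrevE revK cat_take_drop /I subnn; store_eq.
- exists (fun b => T1 b + (T2 b + (6 + (1 + 1)))); first by pbound.
  move=> r a d s b rP fs bP /=; have /and3P[a0 ad _] := rP.
  have rP1 := regs_okS rP; have rP2 := regs_okS rP1.
  have fs2 : free_from d.+2 s by apply: free_from_weak fs; lia.
  have sd : s d = [::] by apply: fs.
  have sd1 : s d.+1 = [::] by apply: fs.
  set m := sat f1 _ _; set n := sat f2 _ _.
  apply: (@run_seq _ _ _ _ _ (upd s d [:: m])).
    have := IH1 r d d.+2 s b (regs_ok_weak (leqnSn _) rP1) fs2 bP.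
    by rewrite sd.
  set s1 := upd s d _.
  have E1 : env_of r s1 = env_of r s by apply: env_of_upd_free rP _.
  have E10 : s1 0 = s 0 by rewrite /s1 upd_other //; apply/eqP; lia.
  apply: (@run_seq _ _ _ _ _ (upd s1 d.+1 [:: n])).
    have := IH2 r d.+1 d.+2 s1 b rP2; rewrite E1 E10.
    rewrite [s1 d.+1](_ : _ = [::]); last first.
      by rewrite /s1 upd_other //; apply/eqP; lia.
    by apply=> //; apply: free_from_upd fs _ _; lia.
  set s2 := upd s1 _ _.
  apply: (@run_seq _ _ _ _ _ (upd s2 a (~~ (m && n) :: s a))).
    have s2d : s2 d = [:: m].
      by rewrite /s2 upd_other ?/s1 ?upd_same //; apply/eqP; lia.
    have s2d1 : s2 d.+1 = [:: n] by rewrite /s2 upd_same.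
    have <- : s2 a = s a by rewrite /s2 /s1 !upd_other //; apply/eqP; lia.
    apply: (run_case (T := 4)); rewrite s2d; case: (m) => /=; last first.
      by apply: run_le (run_push _ _ _).
    by apply: (run_case (T := 2)); rewrite s2d1; case: (n); apply: run_push.
  apply: run_seq (run_pop _ _) _; apply: run_eq (run_pop _ _) _ => u.
  set s3 := upd s2 a _.
  have s3d : s3 d = [:: m].
    by rewrite /s3 /s2 !upd_other ?/s1 ?upd_same //; apply/eqP; lia.
  have s3d1 : s3 d.+1 = [:: n].
    by rewrite /s3 upd_other ?/s2 ?upd_same //; apply/eqP; lia.
  rewrite [upd s3 d _ d.+1]upd_other; last by apply/eqP; lia.
  rewrite s3d s3d1 /= /s3 /s2 /s1.
  store_eq.
- have [T TP IH] := run_tcomp t; have [V VP leV] := leq_teval t.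
  (* The body is evaluated in an environment that also contains the bound variable, whose value is
     below [V b]; hence the bound [b + V b] there. *)
  exists (fun b => T b + ((V b * (1 + (T1 (b + V b) + (4 + 1)) + 2) + 1) +
    (4 + (V b * 3 + 1)))); first by pbound.
  move=> r a d s b rP fs bP /=; have /and3P[a0 ad _] := rP.
  have rP1 := regs_okS rP.
  have fs3 : free_from d.+3 s by apply: free_from_weak fs; lia.
  have sd : s d = [::] by apply: fs.
  have sd1 : s d.+1 = [::] by apply: fs.
  have sd2 : s d.+2 = [::] by apply: fs; lia.
  have := leV _ _ _ bP; set n := teval t _ _ => le_n.
  apply: (@run_seq _ _ _ _ _ (upd s d (nseq n true))).
    have := IH r d d.+3 s b (@regs_ok_weak _ _ _ d.+3 _ rP1) fs3 bP.
    by rewrite sd cats0; apply; lia.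
  set P := fun i => sat f1 (s 0) (i :: env_of r s).
  (* The counter descends and is popped before each evaluation: after [i] rounds the values from
     [n - i] to [n - 1] have been tried. *)
  pose cnt i := count P (iota (n - i) i).
  have le_cnt i : cnt i <= i by rewrite (leq_trans (count_size _ _)) ?size_iota.
  pose I i := upd (upd s d (nseq (n - i) true)) d.+1 (nseq (cnt i) true).
  apply: (@run_seq _ _ _ _ _ (I n)).
    have -> : upd s d (nseq n true) = I 0.
      by rewrite /I subn0 /= [RHS]upd_id // upd_other //; apply/eqP; lia.
    apply: (@run_le _ (n * (1 + (T1 (b + V b) + (4 + 1))).+2 + 1)).
      by rewrite leq_add2r leq_mul // addn2.
    apply: run_while => [i lt_i|]; last first.
      by rewrite /I upd_other ?upd_same ?subnn //; apply/eqP; lia.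
    have Id : I i d = true :: nseq (n - i.+1) true.
      rewrite /I upd_other ?upd_same -?(subnSK lt_i) //.
      by apply/eqP; lia.
    rewrite Id; split=> //; apply: run_seq (run_pop _ _) _; rewrite Id /=.
    set s1 := upd (I i) d _.
    have fs1 : free_from d.+3 s1.
      apply: (@free_from_upd d.+3) => //; last by lia.
      apply: (@free_from_upd d.+3) => //; apply: free_from_upd fs3 _ _ => //; lia.
    have E : env_of (d :: r) s1 = n - i.+1 :: env_of r s.
      rewrite /= /s1 upd_same size_nseq; congr cons.
      by rewrite /I !(env_of_upd_free _ _ rP).
    have E0 : s1 0 = s 0 by rewrite /s1 /I !upd_other //; apply/eqP; lia.
    have := IH1 _ _ _ s1 (b + V b) (regs_ok_cons rP) fs1.
    rewrite E E0 -/(P _) => run1.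
    have {run1} run1 := run1 _.
    have s1d2 : s1 d.+2 = [::] by rewrite /s1 /I !upd_other //; apply/eqP; lia.
    apply: run_seq (run1 _) _.
      case/andP: bP => bx /allP bP; apply/andP; split; first by lia.
      apply/allP => v; rewrite inE => /orP[/eqP ->|/bP]; last by lia.
      by lia.
    rewrite s1d2; set s2 := upd s1 _ _.
    have s2d1 : s2 d.+1 = nseq (cnt i) true.
      rewrite /s2 /s1 upd_other ?upd_other; try by apply/eqP; lia.
      by rewrite /I upd_same.
    have cntS : cnt i.+1 = P (n - i.+1) + cnt i.
      by rewrite /cnt /= subnSK.
    apply: (@run_seq _ _ _ _ _ (upd s2 d.+1 (nseq (cnt i.+1) true))).
      apply: (run_case (T := 2)).
      rewrite {1}/s2 upd_same cntS; case: (P _) => /=.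
        by rewrite -s2d1; apply: run_push.
      by rewrite upd_id //; apply: run_le (run_skip _).
    apply: run_eq (run_pop _ _) _ => u.
    rewrite [X in behead X]upd_other; last by apply/eqP; lia.
    rewrite /s2 upd_same /= /s1 /I; store_eq.
  have hasE : has P (iota 0 n) = (0 < cnt n) by rewrite /cnt subnn has_count.
  apply: (@run_seq _ _ _ _ _ (upd (I n) a (has P (iota 0 n) :: s a))).
    have <- : I n a = s a by rewrite /I !upd_other //; apply/eqP; lia.
    apply: (run_case (T := 2)); rewrite hasE {1}/I upd_same.
    by case: (cnt n) => [|j] /=; apply: run_push.
  apply: (@run_le _ (size (upd (I n) a (has P (iota 0 n) :: s a) d.+1) * 3 + 1)).
    rewrite upd_other; last by apply/eqP; lia.
    by rewrite /I upd_same size_nseq leq_add2r leq_mul2r; have := le_cnt n; lia.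
  apply: run_eq (run_clear _ _) _ => u.
  rewrite /I subnn; store_eq.
Qed.

(** The counter descends, so the bits are pushed from the last to the first and the stack ends up
    holding the output in order. It reaches stack 0 by two transfers, whose reversals cancel. *)
Theorem definable_poly_time (L : term) (phi : formula) :
  poly_time_computable
    (fun x => mkseq (fun j => sat phi x [:: j]) (teval L x [::])).
Proof.
pose c := Seq (tcomp L [::] 2 3) (Seq (While 2 (Seq (Pop 2) (fcomp phi [:: 2] 1 3)))
  (Seq (clear 0) (Seq (transfer 1 3 Skip) (transfer 3 0 Skip)))).
have [T TP IH] := run_tcomp L; have [V VP leV] := leq_teval L.
have [T1 TP1 IH1] := run_fcomp phi.
have [p leP] : poly_bounded (fun b => T b + ((V b * (1 + T1 (b + V b) + 2) + 1) +
    ((b * 3 + 1) + ((V b * 7 + 1) + (V b * 7 + 1))))) by pbound.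
apply: (exec_poly_time (cm := c) (p := p)) => x.
set s := upd _ 0 x; set n := teval L x [::].
set P := fun j => sat phi x [:: j].
suff [t le_t ex] : run c (T (size x) + ((V (size x) *
      (1 + T1 (size x + V (size x)) + 2) + 1) + ((size x * 3 + 1) +
      ((V (size x) * 7 + 1) + (V (size x) * 7 + 1)))))
    s (upd (fun=> [::]) 0 (mkseq P n)).
  exists t, (upd (fun=> [::]) 0 (mkseq P n)); split=> //.
  exact: leq_trans le_t (leP _).
have bP : bounded (size x) x [::] by rewrite /bounded leqnn.
have le_n : n <= V (size x) := leV _ _ _ bP.
apply: (@run_seq _ _ _ _ _ (upd s 2 (nseq n true))).
  have := IH [::] 2 3 s (size x) isT; rewrite /= cats0; apply=> //.
  by move=> v le_v; rewrite /s upd_other //; apply/eqP; lia.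
pose I i := upd (upd s 2 (nseq (n - i) true)) 1 [seq P j | j <- iota (n - i) i].
apply: (@run_seq _ _ _ _ _ (I n)).
  have -> : upd s 2 (nseq n true) = I 0 by rewrite /I subn0 /= [RHS]upd_id.
  apply: (@run_le _ (n * (1 + T1 (size x + V (size x))).+2 + 1)).
    by rewrite leq_add2r leq_mul // addn2.
  apply: run_while => [i lt_i|]; last by rewrite /I upd_other ?upd_same ?subnn.
  have Id : I i 2 = true :: nseq (n - i.+1) true.
    by rewrite /I upd_other ?upd_same -?(subnSK lt_i).
  rewrite Id; split=> //; apply: run_seq (run_pop _ _) _; rewrite Id /=.
  set s1 := upd (I i) 2 _.
  have E : env_of [:: 2] s1 = [:: n - i.+1] by rewrite /= /s1 upd_same size_nseq.
  have := IH1 [:: 2] 1 3 s1 (size x + V (size x)) isT; rewrite E.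
  have -> : s1 0 = x by [].
  have -> : s1 1 = [seq P j | j <- iota (n - i) i] by [].
  rewrite -/(P _) => run1; apply: run_eq (run1 _ _) _.
  + by move=> v le_v; rewrite /s1 /I /s !upd_other //; apply/eqP; lia.
  + by rewrite /bounded /=; apply/andP; split; lia.
  + by move=> u; rewrite /s1 /I -[n - i](subnSK lt_i) /=; store_eq.
apply: (@run_seq _ _ _ _ _ (upd (I n) 0 [::])).
  exact: run_clear.
have def2 : upd (I n) 0 [::] = upd (fun=> [::]) 1 (mkseq P n).
  apply: functional_extensionality => u; rewrite /I /s subnn; store_eq.
rewrite def2; set s2 := upd _ _ _.
have sz : size (s2 1) = n by rewrite /s2 upd_same size_mkseq.
apply: (@run_seq _ _ _ _ _ (upd (fun=> [::]) 3 (rev (mkseq P n)))).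
  apply: (@run_le _ (size (s2 1) * 7 + 1)); first by rewrite sz leq_add2r leq_mul2r.
  apply: run_eq (run_transfer _ _) _ => // u.
  by rewrite /s2 upd_same /rev; store_eq.
set s3 := upd _ 3 _.
have sz3 : size (s3 3) = n by rewrite /s3 upd_same size_rev size_mkseq.
apply: (@run_le _ (size (s3 3) * 7 + 1)); first by rewrite sz3 leq_add2r leq_mul2r.
apply: run_eq (run_transfer _ _) _ => // u.
by rewrite /s3 upd_same catrevE revK cats0; store_eq.
Qed.

(** * Definable functions and predicates *)

(** Definability is a property of Rocq functions of the word and the environment, so that it can be
    established by following the shape of a function, without writing its formula. *)
Definition deft (g : seq bool -> seq nat -> nat) :=
  exists t, forall x e, teval t x e = g x e.

Definition defb (P : seq bool -> seq nat -> bool) :=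
  exists f, forall x e, sat f x e = P x e.

Lemma deft_size : deft (fun x _ => size x).
Proof. by exists TSize. Qed.

Lemma deft_cst n : deft (fun _ _ => n).
Proof. by exists (TCst n). Qed.

Lemma deft_add g h : deft g -> deft h -> deft (fun x e => g x e + h x e).
Proof. by move=> [t tP] [u uP]; exists (TAdd t u) => x e /=; rewrite tP uP. Qed.

Lemma deft_mul g h : deft g -> deft h -> deft (fun x e => g x e * h x e).
Proof. by move=> [t tP] [u uP]; exists (TMul t u) => x e /=; rewrite tP uP. Qed.

Lemma deft_succ g : deft g -> deft (fun x e => (g x e).+1).
Proof. by move=> [t tP]; exists (TAdd t (TCst 1)) => x e /=; rewrite tP addn1. Qed.

Lemma iter_behead (T : Type) k (s : seq T) : iter k behead s = drop k s.
Proof.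
elim: k s => [|k IH] s; first by rewrite drop0.
by rewrite iterSr IH; case: s.
Qed.

(** The rules for quantifiers produce variables in terms of [head] and [behead]; this form matches
    them by conversion. *)
Lemma deft_var k : deft (fun _ e => head 0 (iter k behead e)).
Proof. by exists (TVar k) => x e /=; rewrite iter_behead -nth0 nth_drop addn0. Qed.

Fixpoint tlift k t :=
  match t with
  | TVar i => TVar (k + i)
  | TSize | TCst _ => t
  | TAdd t1 t2 => TAdd (tlift k t1) (tlift k t2)
  | TMul t1 t2 => TMul (tlift k t1) (tlift k t2)
  end.

Lemma deft_weak k g : deft g -> deft (fun x e => g x (iter k behead e)).
Proof.
move=> [t tP]; exists (tlift k t) => x e; rewrite -tP iter_behead.
by elim: t {tP} => //= [i|t1 -> t2 ->|t1 -> t2 ->] //; rewrite nth_drop.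
Qed.

Lemma deft_poly (p : {poly nat}) g : deft g -> deft (fun x e => p.[g x e]%R).
Proof.
move=> gP; rewrite /horner; elim: (polyseq p) => [|c s IH] /=; first exact: deft_cst.
exact: deft_add (deft_mul IH gP) (deft_cst c).
Qed.

Lemma defb_ext P Q : defb P -> (forall x e, P x e = Q x e) -> defb Q.
Proof. by move=> [f fP] PQ; exists f => x e; rewrite fP. Qed.

Lemma defb_le g h : deft g -> deft h -> defb (fun x e => g x e <= h x e).
Proof. by move=> [t tP] [u uP]; exists (FLe t u) => x e /=; rewrite tP uP. Qed.

Lemma defb_bit g : deft g -> defb (fun x e => nth false x (g x e)).
Proof. by move=> [t tP]; exists (FBit t) => x e /=; rewrite tP. Qed.

Lemma defb_nand P Q : defb P -> defb Q -> defb (fun x e => ~~ (P x e && Q x e)).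
Proof. by move=> [f fP] [g gP]; exists (FNand f g) => x e /=; rewrite fP gP. Qed.

Lemma defb_not P : defb P -> defb (fun x e => ~~ P x e).
Proof. by move=> dP; apply: defb_ext (defb_nand dP dP) _ => x e; rewrite andbb. Qed.

Lemma defb_and P Q : defb P -> defb Q -> defb (fun x e => P x e && Q x e).
Proof.
move=> dP dQ; apply: defb_ext (defb_not (defb_nand dP dQ)) _ => x e.
by rewrite negbK.
Qed.

Lemma defb_or P Q : defb P -> defb Q -> defb (fun x e => P x e || Q x e).
Proof.
move=> dP dQ; apply: defb_ext (defb_nand (defb_not dP) (defb_not dQ)) _ => x e.
by rewrite negb_and !negbK.
Qed.

Lemma defb_imp P Q : defb P -> defb Q -> defb (fun x e => P x e ==> Q x e).
Proof.
move=> dP dQ; apply: defb_ext (defb_or (defb_not dP) dQ) _ => x e.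
by rewrite implybE.
Qed.

Lemma defb_cst b : defb (fun _ _ => b).
Proof.
apply: defb_ext (defb_le (deft_cst (~~ b)) (deft_cst 0)) _ => x e.
by case: b.
Qed.

Lemma defb_eq g h : deft g -> deft h -> defb (fun x e => g x e == h x e).
Proof.
move=> dg dh; apply: defb_ext (defb_and (defb_le dg dh) (defb_le dh dg)) _ => x e.
by rewrite eqn_leq.
Qed.

Lemma defb_has g P : deft g -> defb (fun x e => P x (behead e) (head 0 e)) ->
  defb (fun x e => has (P x e) (iota 0 (g x e))).
Proof.
move=> [t tP] [f fP]; exists (FEx t f) => x e /=; rewrite tP.
by apply: eq_has => i; rewrite fP.
Qed.

Lemma defb_all g P : deft g -> defb (fun x e => P x (behead e) (head 0 e)) ->
  defb (fun x e => all (P x e) (iota 0 (g x e))).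
Proof.
move=> dg dP; have dN := @defb_has g (fun x e i => ~~ P x e i) dg (defb_not dP).
apply: defb_ext (defb_not dN) _ => x e; rewrite -all_predC.
by apply: eq_all => i /=; rewrite negbK.
Qed.

(** A list that does not depend on the input is unrolled into a finite disjunction, so the views and
    parts attached to a fixed machine need no arithmetic encoding. *)
Lemma defb_has_static (T : Type) (s : seq T) (P : T -> _) :
  (forall q, defb (P q)) -> defb (fun x e => has (fun q => P q x e) s).
Proof.
by move=> dP; elim: s => [|q s IH] /=; [apply: defb_cst | apply: defb_or].
Qed.

Lemma defb_all_static (T : Type) (s : seq T) (P : T -> _) :
  (forall q, defb (P q)) -> defb (fun x e => all (fun q => P q x e) s).
Proof.
by move=> dP; elim: s => [|q s IH] /=; [apply: defb_cst | apply: defb_and].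
Qed.

Ltac deft_step :=
  cbv beta;
  first [ exact: deft_size | exact: deft_cst
        | exact: (deft_var 0) | exact: (deft_var 1) | exact: (deft_var 2)
        | exact: (deft_var 3) | exact: (deft_var 4) | exact: (deft_var 5)
        | exact: (deft_var 6) | exact: (deft_var 7)
        | match goal with H : deft _ |- _ =>
            first [ exact: (deft_weak 0 H) | exact: (deft_weak 1 H)
                  | exact: (deft_weak 2 H) | exact: (deft_weak 3 H)
                  | exact: (deft_weak 4 H) | exact: (deft_weak 5 H)
                  | exact: (deft_weak 6 H) | exact: (deft_weak 7 H) ] end
        | apply: deft_add | apply: deft_mul | apply: deft_poly | apply: deft_succ ].

(* The order matters: up to reduction, [has _ (iota 0 n.+1)] is a disjunction and
   [m <= n] is an equality. *)
Ltac defb_step :=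
  cbv beta;
  first [ exact: defb_cst | apply: defb_has | apply: defb_all
        | apply: defb_has_static => ? | apply: defb_all_static => ?
        | apply: defb_not | apply: defb_and | apply: defb_or | apply: defb_imp
        | apply: defb_le | apply: defb_eq | apply: defb_bit ].

Ltac definability := repeat first [ deft_step | defb_step ].

Theorem def_poly_time_computable (L : seq bool -> nat) (P : seq bool -> nat -> bool) :
  deft (fun x _ => L x) -> defb (fun x e => P x (head 0 e)) ->
  poly_time_computable (fun x => mkseq (P x) (L x)).
Proof.
move=> [t tP] [f fP]; have [M [p MP]] := definable_poly_time t f.
exists M, p => x; rewrite -[L x](tP x [::]).
have -> : mkseq (P x) (teval t x [::]) =
    mkseq (fun j => sat f x [:: j]) (teval t x [::]).
  by apply: eq_map => j; rewrite fP.
exact: MP.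
Qed.

Corollary def_poly_time_decidable (V : pred (seq bool)) :
  defb (fun x _ => V x) -> poly_time_decidable V.
Proof.
by move=> dV; apply: (@def_poly_time_computable (fun=> 1) (fun x _ => V x)) => //;
  apply: deft_cst.
Qed.

(** * Bits of an instance word *)

Lemma nth_flatten_uniform (T : Type) (x0 : T) n (ss : seq (seq T)) i j :
  all (fun s => size s == n) ss -> i < size ss -> j < n ->
  nth x0 (flatten ss) (i * n + j) = nth x0 (nth [::] ss i) j.
Proof.
elim: ss i => // s ss IH [|i] /= /andP[/eqP sz_s sz_ss] lt_i lt_j.
  by rewrite nth_cat sz_s lt_j.
by rewrite nth_cat sz_s mulSn -addnA ltnNge leq_addr /= addKn IH.
Qed.

Lemma nth_unary m j : nth false (unary m) j = (j < m).
Proof. by rewrite /unary nth_rcons size_nseq nth_nseq; case: ltngtP. Qed.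

Lemma size_unary m : size (unary m) = m.+1.
Proof. by rewrite size_rcons size_nseq. Qed.

Section InstanceWord.
Variables (n : nat) (e : rel 'I_n) (u v : 'I_n).

Lemma size_instance_word : size (instance_word e u v) = n.+1 + n * n + (u.+1 + v.+1).
Proof. by rewrite !size_cat !size_unary size_allpairs size_enum_ord addnA. Qed.

Lemma nth_instance_word j :
  nth false (instance_word e u v) j =
  if j < n.+1 then j < n else
  if j < n.+1 + n * n then
    nth false [seq e x y | x <- enum 'I_n, y <- enum 'I_n] (j - n.+1)
  else if j < n.+1 + n * n + u.+1 then j < n.+1 + n * n + u
  else j < n.+1 + n * n + u.+1 + v.
Proof.
rewrite /instance_word !nth_cat !size_unary size_allpairs size_enum_ord !nth_unary.
case: ltnP => // le_nj; rewrite ltn_subLR //; case: ltnP => // le_j.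
rewrite ltn_subLR; last by lia.
by rewrite ltn_subLR // addnA; case: ltnP => lt_j; lia.
Qed.

Lemma nth_matrix_bit (i j : 'I_n) :
  nth false [seq e x y | x <- enum 'I_n, y <- enum 'I_n] (i * n + j) = e i j.
Proof.
rewrite nth_flatten_uniform; last exact: ltn_ord; last first.
- by rewrite size_map size_enum_ord.
- by apply/allP => s /mapP[a _ ->]; rewrite size_map size_enum_ord.
rewrite (nth_map i) ?size_enum_ord // (nth_map j) ?size_enum_ord //.
by rewrite !nth_ord_enum.
Qed.

Lemma instance_word_eq (w : seq bool) :
  size w = n.+1 + n * n + (u.+1 + v.+1) ->
  (forall i, i < n -> nth false w i) -> ~~ nth false w n ->
  (forall i j : 'I_n, nth false w (n.+1 + (i * n + j)) = e i j) ->
  (forall i, i <= u -> nth false w (n.+1 + n * n + i) = (i < u)) ->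
  (forall i, i <= v -> nth false w (n.+1 + n * n + u.+1 + i) = (i < v)) ->
  w = instance_word e u v.
Proof.
move=> sz w1 w2 w3 w4 w5; apply: (@eq_from_nth _ false).
  by rewrite size_instance_word.
move=> j; rewrite sz => lt_j; rewrite nth_instance_word.
case: (ltnP j n.+1) => [le_jn|lt_nj].
  move: le_jn; rewrite ltnS leq_eqVlt => /orP[/eqP ->|lt_jn].
    by rewrite ltnn; apply: negbTE.
  by rewrite lt_jn w1.
case: (ltnP j (n.+1 + n * n)) => [lt_j1|le_j1].
  have lt_k : j - n.+1 < n * n by rewrite ltn_subLR.
  have n0 : 0 < n by case: (n) lt_k.
  have lt_a : (j - n.+1) %/ n < n by rewrite ltn_divLR.
  have lt_b : (j - n.+1) %% n < n by rewrite ltn_mod.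
  rewrite {1}(_ : j = n.+1 + (Ordinal lt_a * n + Ordinal lt_b)); last first.
    by rewrite /= -divn_eq subnKC.
  by rewrite w3 -nth_matrix_bit /= -divn_eq.
case: (ltnP j (n.+1 + n * n + u.+1)) => [lt_j2|le_j2].
  rewrite -(subnKC le_j1) w4; last by lia.
  by rewrite ltn_add2l.
rewrite -(subnKC le_j2) w5; last by lia.
by rewrite ltn_add2l.
Qed.

Lemma instance_wordE (f : seq bool) : f = instance_word e u v ->
  [/\ size f = n.+1 + n * n + (u.+1 + v.+1),
      forall i, i < n -> nth false f i,
      ~~ nth false f n &
  [/\ forall i j : 'I_n, nth false f (n.+1 + (i * n + j)) = e i j,
      forall i, i <= u -> nth false f (n.+1 + n * n + i) = (i < u) &
      forall i, i <= v -> nth false f (n.+1 + n * n + u.+1 + i) = (i < v)]].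
Proof.
move=> ->; split; first exact: size_instance_word.
- by move=> i lt_i; rewrite nth_instance_word ltnS (ltnW lt_i).
- by rewrite nth_instance_word ltnS leqnn ltnn.
split.
- move=> i j; rewrite nth_instance_word ltnNge leq_addr /= ltn_add2l addKn.
  rewrite nth_matrix_bit ifT //.
  apply: (@leq_trans (i.+1 * n)); last by rewrite leq_mul2r ltn_ord orbT.
  by rewrite mulSn addnC ltn_add2r.
- by move=> i le_i; rewrite nth_instance_word; do 3![case: ifP => ?; first lia]; lia.
- by move=> i le_i; rewrite nth_instance_word; do 3![case: ifP => ?; first lia]; lia.
Qed.

End InstanceWord.

(** * Separators and binary constraint satisfaction *)

(** The fibres of [phi] cover [S] by [k] cliques, and an independent set meets each of them at most
    once. *)
Lemma alpha_leq_cover (T : finType) (e : rel T) (S : {set T}) k (phi : T -> 'I_k) :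
  {in S &, forall s s', s != s' -> phi s = phi s' -> e s s'} -> alpha e S <= k.
Proof.
move=> cover; apply/bigmax_leqP => I /andP[sIS indI].
rewrite -[leqRHS]card_ord -(@card_in_imset _ _ phi I) ?max_card // => a b aI bI eq_phi.
apply/eqP/negPn/negP => ab.
have /forall_inP /(_ a aI) /forall_inP /(_ b bI) /negP := indI; apply.
by apply: cover eq_phi => //; apply: (subsetP sIS).
Qed.

Lemma size_leq_alpha (T : finType) (e : rel T) (S : {set T}) (s : seq T) :
  uniq s -> {subset s <= S} -> {in s &, forall a b, ~~ e a b} -> size s <= alpha e S.
Proof.
move=> us sS ind; rewrite -(card_uniqP us).
have -> : #|s| = #|[set a in s]| by apply: eq_card => a; rewrite inE.
apply: leq_bigmax_cond; apply/andP; split.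
  by apply/subsetP => a; rewrite inE; apply: sS.
apply/forall_inP => a; rewrite inE => aI; apply/forall_inP => b; rewrite inE => bI.
exact: ind.
Qed.

Lemma alpha_gt_indep (T : finType) (e : rel T) (S : {set T}) k :
  k < alpha e S -> exists s : seq T, [/\ size s = k.+1, uniq s, {subset s <= S} &
    {in s &, forall a b, ~~ e a b}].
Proof.
move=> lt_k; have [I /andP[sIS indI] eI] : exists2 I : {set T},
    (I \subset S) && independent e I & alpha e S = #|I|.
  have P0 : (set0 \subset S) && independent e set0.
    by rewrite sub0set; apply/forall_inP => a; rewrite inE.
  rewrite /alpha (bigop.bigmax_eq_arg set0) //.
  by case: arg_maxnP => // I IP _; exists I.
exists (take k.+1 (enum I)); have sub : {subset take k.+1 (enum I) <= I}.
  by move=> a /mem_take; rewrite mem_enum.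
split.
- by rewrite size_takel // -cardE -eI.
- by apply: take_uniq; apply: enum_uniq.
- by move=> a /sub; apply: (subsetP sIS).
- move=> a b /sub aI /sub bI.
  by have /forall_inP /(_ a aI) /forall_inP /(_ b bI) := indI.
Qed.

(** A path from [u] that avoids [S] cannot leave [C]. The set [C] is thus a positive witness for the
    absence of a path. *)
Lemma separator_closed (T : finType) (e : rel T) (u v : T) (S C : {set T}) :
  u \notin S -> v \notin S -> u \in C -> v \notin C ->
  (forall a b, a \in C -> e a b -> b \in C :|: S) -> separator e u v S.
Proof.
move=> uS vS uC vC closed; split=> // -[p [ep lp _ pS]].
move: vC; rewrite -lp => /negP; apply.
have {}pS : {in p, forall x, x \notin S} by move=> x xp; apply: pS; rewrite inE xp orbT.
elim: p u uC ep pS {uS lp} => //= b p IH a aC /andP[ab ep] pS.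
apply: IH ep _; last by move=> x xp; apply: pS; rewrite inE xp orbT.
have := closed _ _ aC ab; rewrite inE => /orP[] // bS.
by have := pS b; rewrite inE eqxx bS => /(_ isT).
Qed.

Lemma separator_component (T : finType) (e : rel T) (u v : T) (S : {set T}) :
  separator e u v S -> exists C : {set T}, [/\ u \in C, v \notin C &
    forall a b, a \in C -> e a b -> b \in C :|: S].
Proof.
case=> uS vS nopath; pose e' := [rel a b | e a b && (b \notin S)].
exists [set a | connect e' u a]; split.
- by rewrite inE connect0.
- rewrite inE; apply/negP => /connectP[p ep lp]; apply: nopath.
  (* Connectivity gives a walk, whereas separators are about paths without repetition. *)
  move: lp; case/shortenP: ep => p1 ep1 up1 _ lp; exists p1; split=> //.
    by apply: sub_path ep1 => a b /andP[].
  move=> x; rewrite inE => /orP[/eqP -> //|].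
  elim: p1 (u) ep1 {up1 lp} => //= b p1 IH a /andP[/andP[_ bS] ep1].
  by rewrite inE => /orP[/eqP -> //|]; apply: IH ep1.
- move=> a b; rewrite !inE => ua ab; case: (boolP (b \in S)) => bS; rewrite ?orbT // orbF.
  by apply: connect_trans ua (connect1 _); rewrite /= ab.
Qed.

Section Gadget.
Variables (D : finType) (k : nat).

(* [inl (d, r, s)] is an element on the side of the terminal [s]: [r = 0] stands
   for "the value is d", [r = 1] for "the value comes after d", and [r = 2] for
   "the value comes before d".  [inr (inl b)] is a terminal and [inr (inr i)] is
   a vertex adjacent to both terminals.  These are isolated unless they are paired
   with the variable [x0]. *)
Definition gadget_part : finType := (D * 'I_3 * bool + (bool + 'I_k))%type.

(** The second case links the triangles of a variable into a chain: the value cannot come both after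
    [d] and before the successor of [d]. *)
Definition elt_conflict (eqx : bool) (cf : D -> D -> bool) (a b : D * 'I_3) : bool :=
  [|| [&& a.2 == 0 :> nat, b.2 == 0 :> nat & cf a.1 b.1]
    | [&& eqx, a.2 == 1 :> nat, b.2 == 2 :> nat &
        enum_rank b.1 == (enum_rank a.1).+1 :> nat]].

Definition elt_disabled (bad : D -> bool) (a : D * 'I_3) : bool :=
  [|| (a.2 == 0 :> nat) && bad a.1
    , (a.2 == 2 :> nat) && (enum_rank a.1 == 0 :> nat)
    | (a.2 == 1 :> nat) && ((enum_rank a.1).+1 == #|D|)].

(** In an independent set, an enabled element of A excludes vertex 0 and an element of B excludes
    vertices 1 and 2. A disabled element of A excludes none of the [k] vertices, so it cannot lie in
    a good separator. *)
Definition special_adj (bad : D -> bool) (a : D * 'I_3 * bool) (sp : bool + 'I_k) :=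
  match sp with
  | inl b => b == a.2
  | inr i => if a.2 then (i == 0 :> nat) && ~~ elt_disabled bad a.1
             else (i == 1 :> nat) || (i == 2 :> nat)
  end.

(** Inside A this is the complement of the conflict graph; inside B it is the complement of a
    disjoint union of triangles, one for each variable and value. The variables enter only through
    booleans and relations, so that the same definition serves for the graph and for the formula
    that describes it. *)
Definition part_adj (eqx zl zr : bool) (cf cf' : D -> D -> bool)
    (badl badr : D -> bool) (q q' : gadget_part) : bool :=
  match q, q' with
  | inl (d, r, s), inl (d', r', s') =>
      if s != s' then eqx && ((d, r) == (d', r')) else
      if s then ~~ [|| eqx && ((d, r) == (d', r')),
          elt_conflict eqx cf (d, r) (d', r') | elt_conflict eqx cf' (d', r') (d, r)]
      else ~~ (eqx && (d == d'))
  | inl a, inr sp => zr && special_adj badl a sp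
  | inr sp, inl a => zl && special_adj badr a sp
  | inr (inl _), inr (inr _) | inr (inr _), inr (inl _) => zl && zr
  | _, _ => false
  end.

Variables (X : finType) (x0 : X) (conf : X -> X -> D -> D -> bool) (bad : X -> D -> bool).

Definition gadget (p p' : X * gadget_part) : bool :=
  part_adj (p.1 == p'.1) (p.1 == x0) (p'.1 == x0) (conf p.1 p'.1) (conf p'.1 p.1)
    (bad p.1) (bad p'.1) p.2 p'.2.

Definition terminal (b : bool) : X * gadget_part := (x0, inr (inl b)).

Lemma gadget_simple : simple_graph gadget.
Proof.
split.
  move=> [x q] [x' q']; rewrite /gadget /= [x' == x]eq_sym.
  case: q q' => [[[d r] s]|[b|i]] [[[d' r'] s']|[b'|i']] //=; last 2 first.
  - by rewrite andbC.
  - by rewrite andbC.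
  rewrite [s' == s]eq_sym [(d', r') == _]eq_sym [d' == d]eq_sym.
  case: eqP => //= <-; case: s => //=; congr (~~ (_ || _)); exact: orbC.
move=> [x q]; rewrite /gadget /= !eqxx.
by case: q => [[[d r] [|]]|[b|i]] //=; rewrite !eqxx.
Qed.

Definition solution (f : X -> D) :=
  (forall x, ~~ bad x (f x)) /\ (forall x x', x != x' -> ~~ conf x x' (f x) (f x')).

Hypothesis k_ge3 : 3 <= k.

Let forced i : X * gadget_part := (x0, inr (inr i)).
Let elt x d r s : X * gadget_part := (x, inl (d, r, s)).

(** Exactly one element of each triangle is true of [f]. The separator takes its copy in A and the
    copies in B of the other two; [C] consists of [u] and the remaining copies in A. Cover by [k]
    cliques: the chosen part of A with vertex 0, the two elements left in each triangle shared
    between the classes of 1 and 2, and each further special vertex alone. *)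
Lemma solution_separator f : solution f ->
  exists S, separator gadget (terminal true) (terminal false) S /\ alpha gadget S <= k.
Proof.
move=> [fbad fconf].
pose chosen x d (r : 'I_3) : bool :=
  if r == 0 :> nat then f x == d else
  if r == 1 :> nat then enum_rank d < enum_rank (f x) else enum_rank (f x) < enum_rank d.
pose S : {set X * gadget_part} := [set p | match p.2 with
  | inl (d, r, s) => s == chosen p.1 d r
  | inr (inl _) => false
  | inr (inr _) => p.1 == x0 end].
pose C : {set X * gadget_part} := [set p | match p.2 with
  | inl (d, r, s) => s && ~~ chosen p.1 d r
  | inr (inl b) => b && (p.1 == x0)
  | inr (inr _) => false end].
exists S; split.
  apply: (@separator_closed _ _ _ _ S C); rewrite ?inE ?eqxx //=.
  move=> [x q] [x' q']; rewrite !inE /gadget /=.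
  case: q => [[[d r] s]|[b|i]] //=.
    case: s => //= nch; case: q' => [[[d' r'] s']|[b'|i']] /=.
    - case: s' => /=; first by case: (chosen x' d' r').
      by case/andP=> /eqP <- /eqP[<- <-]; rewrite (negPf nch).
    - by case/andP=> -> /eqP ->.
    - by case/andP=> ->.
  case: b => //= /eqP ->; case: q' => [[[d' r'] s']|[b'|i']] //=.
    by rewrite eqxx /= => /eqP <-; case: (chosen x' d' r').
  by case/andP.
have H0 : 0 < k by lia.
have H1 : 1 < k by lia.
have H2 : 2 < k by lia.
(* The two unchosen elements of each triangle get the colours 1 and 2. *)
pose col x d (r : 'I_3) : 'I_k :=
  if r == 0 :> nat then Ordinal H1 else if r == 2 :> nat then Ordinal H2 else
  if f x == d then Ordinal H1 else Ordinal H2.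
pose phi (p : X * gadget_part) : 'I_k := match p.2 with
  | inl (d, r, s) => if s then Ordinal H0 else col p.1 d r
  | inr (inr i) => i
  | inr (inl _) => Ordinal H0 end.
apply: (@alpha_leq_cover _ _ _ _ phi).
have notdis x d r : chosen x d r -> ~~ elt_disabled (bad x) (d, r).
  rewrite /chosen /elt_disabled /=; case: r => [[|[|[|r]]]] //= _.
  - by move=> /eqP <-; rewrite orbF (negPf (fbad x)).
  - move=> lt_d; apply: contraTN lt_d => /eqP E; rewrite -leqNgt -ltnS E; exact: ltn_ord.
  - by rewrite orbF -lt0n; apply: leq_ltn_trans.
have noconf x d r x' d' r' : elt x d r true != elt x' d' r' true ->
    chosen x d r -> chosen x' d' r' ->
    ~~ elt_conflict (x == x') (conf x x') (d, r) (d', r').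
  rewrite /chosen /elt_conflict /= => neq.
  case: r neq => [[|[|[|r]]]] //= lt_r; case: r' => [[|[|[|r']]]] //= lt_r' neq;
    rewrite ?andbF ?orbF //.
  - move=> /eqP ed /eqP ed'; subst d d'; apply: fconf; apply: contra neq => /eqP ->.
    by rewrite (bool_irrelevance lt_r lt_r').
  - by case: eqP => //= <- lt1 lt2; apply/eqP; lia.
have colneq x d (r r' : 'I_3) : r != r' -> ~~ chosen x d r -> ~~ chosen x d r' ->
    col x d r != col x d r'.
  rewrite /chosen /col /=.
  case: r => [[|[|[|r]]]] //= ?; case: r' => [[|[|[|r']]]] //= ? _; rewrite -?val_eqE //=.
  - by move/negPf => ->.
  - by move=> _ /negPf ->.
  - by case: (f x =P d) => //= nE; rewrite -!leqNgt => le1 le2; case: nE;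
      apply: enum_rank_inj; apply: val_inj; apply/eqP; rewrite eqn_leq le1.
  - by case: (f x =P d) => //= nE; rewrite -!leqNgt => le1 le2; case: nE;
      apply: enum_rank_inj; apply: val_inj; apply/eqP; rewrite eqn_leq le2.
have colP x d r : (col x d r == 1 :> nat) || (col x d r == 2 :> nat).
  by rewrite /col; case: ifP => // _; case: ifP => // _; case: ifP.
have bcase x d r (b : bool) : b == chosen x d r -> b = chosen x d r by move/eqP.
move=> [x q] [x' q']; rewrite !inE /gadget /phi /=.
case: q => [[[d r] s]|[b|i]] //=; case: q' => [[[d' r'] s']|[b'|i']] //=.
- move=> /eqP es /eqP es'; case: s es => es; case: s' es' => es' /=.
  + move=> neq _.
    have neq' : elt x' d' r' true != elt x d r true by rewrite eq_sym.
    have := noconf _ _ _ _ _ _ neq' (esym es') (esym es); rewrite [x' == x]eq_sym => nc.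
    rewrite negb_or negb_or nc (noconf _ _ _ _ _ _ neq (esym es) (esym es')) !andbT.
    apply: contra neq => /andP[/eqP -> /eqP[-> ->]]; exact: eqxx.
  + by move=> _ E; have := colP x' d' r'; rewrite -E.
  + by move=> _ E; have := colP x d r; rewrite E.
  + move=> neq E; apply/negP => /andP[/eqP ex /eqP ed]; subst x' d'.
    case: (eqVneq r r') => er; first by rewrite er eqxx in neq.
    by have := colneq x d _ _ er; rewrite -es -es' E eqxx => /(_ isT isT).
- move=> /eqP es /eqP -> _; rewrite eqxx; case: s es => es E.
    by rewrite -E /= notdis.
  by rewrite -E colP.
- move=> /eqP -> /eqP es' _; rewrite eqxx; case: s' es' => es' E.
    by rewrite E /= notdis.
  by rewrite E colP.
- by move=> /eqP -> /eqP ->; move=> neq E; rewrite E eqxx in neq.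
Qed.

(** The paths of length two through the special vertices and of length three through the two copies
    of an element force the former, and one copy of each element, into [S]. The value of a variable
    is any [d] whose element of kind 0 has its A copy in [S]. *)
Lemma separator_solution (d0 : D) S :
  separator gadget (terminal true) (terminal false) S -> alpha gadget S <= k ->
  exists f, solution f.
Proof.
move=> [uS vS nopath] leS.
have H0 : 0 < k by lia.
have H1 : 1 < k by lia.
have H2 : 2 < k by lia.
have tf b i : terminal b != forced i by apply/eqP.
have te b x d r s : terminal b != elt x d r s by apply/eqP.
have et b x d r s : elt x d r s != terminal b by apply/eqP.
have ee x d r : elt x d r true != elt x d r false by apply/eqP; case.
have forcedS i : forced i \in S.
  apply/negPn/negP => iS; apply: nopath; exists [:: forced i; terminal false].
  split=> //; first by rewrite /= /gadget /= !eqxx.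
    by rewrite /= !inE negb_or tf.
  by move=> p; rewrite !inE => /or3P[] /eqP ->.
have eltS x d r : (elt x d r true \in S) || (elt x d r false \in S).
  apply/negPn/negP; rewrite negb_or => /andP[aS bS]; apply: nopath.
  exists [:: elt x d r true; elt x d r false; terminal false].
  split=> //; first by rewrite /= /gadget /= !eqxx.
    rewrite /= !inE !negb_or; do !(apply/andP; split=> //); by apply/eqP; case.
  by move=> p; rewrite !inE => /or4P[] /eqP ->.
pose fs (P : pred nat) := [seq forced i | i <- enum [pred i : 'I_k | P i]].
have indep s : uniq s -> {subset s <= S} -> {in s &, forall a b, ~~ gadget a b} ->
    size s <= k.
  by move=> us sS ind; apply: leq_trans leS; apply: size_leq_alpha.
have sym := proj1 gadget_simple; have irr := proj2 gadget_simple.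
have forced_inj : injective forced by move=> i j [].
have fsU P : uniq (fs P) by rewrite map_inj_uniq // enum_uniq.
have fsS P : {subset fs P <= S} by move=> p /mapP[i _ ->].
have szfs P : size (fs P) = #|[pred i : 'I_k | P i]| by rewrite size_map -cardE.
(* Independent elements of [S] can be completed by special vertices not adjacent to them. The sizes
   [1 + k], [2 + (k - 1)] and [3 + (k - 2)] then rule out a disabled element, a conflicting pair,
   and a triangle of B. *)
have big (l : seq (X * gadget_part)) (P : pred nat) :
    uniq l -> {subset l <= S} -> {in l &, forall a b, ~~ gadget a b} ->
    (forall a, a \in l -> if a.2 is inl _ then true else false) ->
    (forall a (i : 'I_k), a \in l -> P i -> ~~ gadget a (forced i)) ->
    size l + #|[pred i : 'I_k | P i]| <= k.
  move=> ul lS lind lelt lfs; rewrite -szfs -size_cat; apply: indep.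
  - rewrite cat_uniq ul fsU andbT /=; apply/hasPn => p /mapP[i _ ->].
    by apply/negP => /lelt.
  - by move=> p; rewrite mem_cat => /orP[/lS|/fsS].
  - move=> p p'; rewrite !mem_cat => /orP[pl|/mapP[i iP ->]] /orP[p'l|/mapP[j jP ->]].
    + exact: lind.
    + by apply: lfs => //; move: jP; rewrite mem_enum.
    + by rewrite sym; apply: lfs => //; move: iP; rewrite mem_enum.
    + by [].
have cardk : #|[pred i : 'I_k | true]| = k by rewrite -[RHS]card_ord; apply: eq_card.
have card1 j : j < k -> #|[pred i : 'I_k | i != j :> nat]| = k.-1.
  move=> lt_j; rewrite -[in RHS](card_ord k) -(cardC1 (Ordinal lt_j)).
  by apply: eq_card => i.
have dis x d r : elt x d r true \in S -> ~~ elt_disabled (bad x) (d, r).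
  move=> aS; apply/negP => dP.
  have := big [:: elt x d r true] xpredT; rewrite cardk /= add1n ltnn => H.
  suff : false by []; apply: H => //.
  - by move=> a; rewrite inE => /eqP ->.
  - by move=> a b; rewrite !inE => /eqP -> /eqP ->; rewrite irr.
  - by move=> a; rewrite inE => /eqP ->.
  - by move=> a i; rewrite inE => /eqP -> _; rewrite /gadget /= dP !andbF.
have cf x d r x' d' r' : elt x d r true \in S -> elt x' d' r' true \in S ->
    elt x d r true != elt x' d' r' true ->
    ~~ elt_conflict (x == x') (conf x x') (d, r) (d', r').
  move=> aS bS ab; apply/negP => cP.
  have nadj : ~~ gadget (elt x d r true) (elt x' d' r' true).
    by rewrite /gadget /= cP orbT.
  have := big [:: elt x d r true; elt x' d' r' true] (fun i => i != 0).
  rewrite card1 //= add2n prednK // ltnn => H.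
  suff : false by []; apply: H => //.
  - by rewrite inE ab.
  - by move=> a; rewrite !inE => /orP[] /eqP ->.
  - move=> a b; rewrite !inE => /orP[] /eqP -> /orP[] /eqP -> //; rewrite ?irr //.
    by rewrite sym.
  - by move=> a; rewrite !inE => /orP[] /eqP ->.
  - move=> a i; rewrite !inE => /orP[] /eqP -> /negPf i0;
      by rewrite /gadget /= i0 !andbF.
pose r0 : 'I_3 := inord 0; pose r1 : 'I_3 := inord 1; pose r2 : 'I_3 := inord 2.
have tri x d : [|| elt x d r0 true \in S, elt x d r1 true \in S | elt x d r2 true \in S].
  apply/negPn/negP; rewrite !negb_or => /and3P[n0 n1 n2].
  have bS r : elt x d r true \notin S -> elt x d r false \in S.
    by move=> nr; have := eltS x d r; rewrite (negPf nr).
  have := big [:: elt x d r0 false; elt x d r1 false; elt x d r2 false]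
    (fun i => (i != 1) && (i != 2)).
  have -> : #|[pred i : 'I_k | (i != 1 :> nat) && (i != 2 :> nat)]| = k - 2.
    have := cardC [pred i : 'I_k | (i != 1 :> nat) && (i != 2 :> nat)].
    rewrite card_ord (_ : #|[predC _]| = #|pred2 (Ordinal H1) (Ordinal H2)|).
      by rewrite card2 => E; apply/eqP; rewrite -(eqn_add2r 2) E subnK.
    by apply: eq_card => i; rewrite !inE negb_and !negbK.
  move=> H; suff : 3 + (k - 2) <= k by lia.
  apply: H.
  - rewrite -[[:: _; _; _]]/(map (fun r => elt x d r false) [:: r0; r1; r2]).
    rewrite map_inj_uniq; last by move=> r r' [].
    by rewrite /= !inE /r0 /r1 /r2 -!(inj_eq val_inj) /= !inordK.
  - by move=> a; rewrite !inE => /or3P[] /eqP ->; apply: bS.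
  - by move=> a b; rewrite !inE => /or3P[] /eqP -> /or3P[] /eqP ->;
      rewrite /gadget /= !eqxx.
  - by move=> a; rewrite !inE => /or3P[] /eqP ->.
  - move=> a i; rewrite !inE => /or3P[] /eqP -> /andP[/negPf i1 /negPf i2];
      by rewrite /gadget /= i1 i2 !andbF.
have ex x : exists d, elt x d r0 true \in S.
  have [d dS|none] := pickP (fun d => elt x d r0 true \in S); first by exists d.
  have n0 : 0 < #|D| by apply/card_gt0P; exists d0.
  (* If no value is selected, every triangle selects its element of kind 1: before the first value
     is disabled, and before a later value conflicts with after the preceding one. At the last value
     this contradicts [dis]. *)
  have all1 j (lt_j : j < #|D|) : elt x (enum_val (Ordinal lt_j)) r1 true \in S.
    elim: j lt_j => [|j IH] lt_j; have := tri x (enum_val (Ordinal lt_j));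
      rewrite none /= => /orP[] // S2.
      by have := dis _ _ _ S2; rewrite /elt_disabled /= enum_valK inordK //= orbT.
    have S1 := IH (ltnW lt_j).
    have neq : elt x (enum_val (Ordinal (ltnW lt_j))) r1 true !=
        elt x (enum_val (Ordinal lt_j)) r2 true.
      by apply/eqP => -[_ /(congr1 val)]; rewrite /r1 /r2 /= !inordK.
    have := cf _ _ _ _ _ _ S1 S2 neq.
    by rewrite /elt_conflict /= !enum_valK /r1 /r2 !inordK //= !eqxx.
  have lt_n : #|D|.-1 < #|D| by rewrite prednK.
  by have := dis _ _ _ (all1 _ lt_n);
    rewrite /elt_disabled /= enum_valK inordK //= prednK // eqxx.
exists (fun x => xchoose (ex x)).
have fS x := xchooseP (ex x); split=> [x|x x'].
  by have := dis _ _ _ (fS x); rewrite /elt_disabled /= inordK //= orbF.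
move=> N; have := cf _ _ _ _ _ _ (fS x) (fS x').
rewrite /elt_conflict /= !inordK //= (negPf N) orbF; apply.
by rewrite /elt -!pair_eqE /= (negPf N).
Qed.

End Gadget.

(** * The tableau of a machine *)

Lemma size_pair_word x w : size (pair_word x w) = 2 * size x + (size w).+1.
Proof. by rewrite /pair_word; elim: x => //= b x IH; rewrite IH; lia. Qed.

Lemma nth_pair_word_even x w i : i < size x -> nth false (pair_word x w) (2 * i).
Proof.
rewrite /pair_word; elim: x i => // b x IH [|i] lt_i //.
by rewrite mulnS add2n; apply: IH.
Qed.

Lemma nth_pair_word_odd x w i : i < size x ->
  nth false (pair_word x w) (2 * i).+1 = nth false x i.
Proof.
rewrite /pair_word; elim: x i => // b x IH [|i] lt_i //.
by rewrite mulnS add2n; apply: IH.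
Qed.

Lemma nth_pair_word_sep x w : nth false (pair_word x w) (2 * size x) = false.
Proof.
rewrite /pair_word; elim: x => // b x IH.
by rewrite (_ : 2 * size (b :: x) = (2 * size x).+2) // mulnS.
Qed.

Lemma nth_pair_word_cert x w i :
  nth false (pair_word x w) ((2 * size x).+1 + i) = nth false w i.
Proof.
rewrite /pair_word; elim: x => // b x IH.
by rewrite (_ : (2 * size (b :: x)).+1 + i = ((2 * size x).+1 + i).+2) // mulnS.
Qed.

Section Tapes.
Variable A : finType.
Implicit Types (t : tape A) (am : symbol A * move).

Definition left_cell t c := nth None (before t) c.
Definition right_cell t c := nth None (after t) c.

(* [b], [a] are the cells at distance [c] left and right of the head before a
   move, and [b'], [a'] those at distance [c'] after it. *)
Definition move_ok am c c' (b a b' a' : symbol A) : bool :=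
  match am.2 with
  | MoveLeft =>
      [&& (c == c'.+1) ==> (b' == b), (c == 0) && (c' == 0) ==> (a' == b),
        (c == 0) && (c' == 1) ==> (a' == am.1) &
        (0 < c) && (c' == c.+1) ==> (a' == a)]
  | Stay =>
      [&& (c == c') ==> (b' == b), (c == 0) && (c' == 0) ==> (a' == am.1) &
        (0 < c) && (c' == c) ==> (a' == a)]
  | MoveRight =>
      [&& (c == 0) && (c' == 0) ==> (b' == am.1), (c' == c.+1) ==> (b' == b) &
        (c == c'.+1) ==> (a' == a)]
  end.

Lemma move_ok_write t am c c' :
  move_ok am c c' (left_cell t c) (right_cell t c)
    (left_cell (write_move t am) c') (right_cell (write_move t am) c').
Proof.
case: t am => l r [a []]; rewrite /move_ok /left_cell /right_cell /=.
- apply/and4P; split; apply/implyP.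
  + by move/eqP => ->; case: l => //=; rewrite nth_nil.
  + by case/andP=> /eqP -> /eqP ->; case: l.
  + by case/andP=> _ /eqP ->.
  + by case/andP; case: c => // c _ /eqP ->; case: r => //=; rewrite nth_nil.
- apply/and3P; split; apply/implyP.
  + by move/eqP => ->.
  + by case/andP=> _ /eqP ->.
  + by case/andP; case: c => // c _ /eqP ->; case: r => //=; rewrite nth_nil.
- apply/and3P; split; apply/implyP.
  + by case/andP=> _ /eqP ->.
  + by move/eqP => ->.
  + by move/eqP => ->; case: r => //=; rewrite nth_nil.
Qed.

(** A cell at distance [c'] after a move is either the written symbol or a cell whose distance
    before it differed from [c'] by at most one. Each clause involves one distance before and one
    after, so binary constraints determine the new tape. *)
Lemma move_ok_det t am c' b' a' :
  (forall c, c' <= c.+1 -> c <= c'.+1 ->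
     move_ok am c c' (left_cell t c) (right_cell t c) b' a') ->
  b' = left_cell (write_move t am) c' /\ a' = right_cell (write_move t am) c'.
Proof.
case: t am => l r [a []]; rewrite /move_ok /left_cell /right_cell /= => H.
- have /and4P[/implyP /(_ (eqxx _)) /eqP -> _ _ _] := H c'.+1 (leqW (leqnSn _)) (leqnn _).
  split; first by case: (l) => //=; rewrite nth_nil.
  case: c' H => [|[|c']] H.
  + by have /and4P[_ /eqP -> _ _] := H 0 isT isT; case: (l).
  + by have /and4P[_ _ /eqP -> _] := H 0 isT isT.
  + have le_c : c'.+1 <= c'.+3 by rewrite ltnW.
    have := H c'.+1 (leqnn _) le_c; rewrite !eqxx /= => /andP[_ /eqP ->] /=.
    by case: (r) => //=; rewrite nth_nil.
- have := H c' (leqnSn _) (leqnSn _); rewrite eqxx => /and3P[/eqP -> a1 a2].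
  split=> //; case: c' a1 a2 {H} => [/eqP -> //|c' _ /eqP ->].
  by case: (r) => //=; rewrite nth_nil.
- have := H c'.+1 (leqW (leqnSn _)) (leqnn _); rewrite eqxx => /and3P[_ _ /eqP ->].
  split; last by case: (r) => //=; rewrite nth_nil.
  case: c' H => [|c'] H.
    by have /and3P[/eqP -> _ _] := H 0 isT isT.
  have le_c : c' <= c'.+2 by rewrite ltnW.
  by have := H c' (leqnn _) le_c; rewrite !eqxx /= => /and3P[_ /eqP -> _].
Qed.

(** If blanks propagate to the right, a row of bits and blanks is a word followed by blanks. The
    certificate, of unknown length, is recovered from the guessed cells in this way. *)
Lemma leading_bits_closed (l : seq (symbol A)) :
  (forall j, j < size l -> nth None l j = None \/ exists b, nth None l j = Some (inl b)) ->
  (forall j, j.+1 < size l -> nth None l j = None -> nth None l j.+1 = None) ->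
  forall j, nth None l j = nth None [seq Some (inl b) | b <- leading_bits l] j.
Proof.
elim: l => [|a l IH] bits closed j; first by rewrite nth_nil.
have [/= a0|[b /= ab]] := bits 0 isT.
  rewrite a0 nth_nil; elim: j => [|j IHj] //=.
  case: (ltnP j (size l)) => lt_j; last by rewrite nth_default.
  have := closed j lt_j; rewrite /= a0; apply; exact: IHj.
rewrite ab /=; case: j => //= j; apply: IH => [i lt_i|i lt_i].
  exact: (bits i.+1).
exact: (closed i.+1).
Qed.

Lemma size_leading_bits (l : seq (symbol A)) : size (leading_bits l) <= size l.
Proof. by elim: l => //= -[[b|a]|] l IH. Qed.

End Tapes.

Section Tableau.
Variable M : machine.
Let A := work_symbol M.
Let tapes := 'I_(work_tapes M).+1.

(* A view of a configuration at distance [c] from the heads: the state, the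
   scanned symbols, and for each tape the two cells at distance [c]. *)
Definition view : finType :=
  (state M * {ffun tapes -> symbol A} * {ffun tapes -> symbol A * symbol A})%type.

Definition view_state (d : view) := d.1.1.
Definition view_scan (d : view) := d.1.2.
Definition view_left (d : view) i := (d.2 i).1.
Definition view_right (d : view) i := (d.2 i).2.

Definition action (d : view) : state M * {ffun tapes -> symbol A * move} :=
  if halting (view_state d) then (view_state d, [ffun i => (view_scan d i, Stay)])
  else transition (view_state d) (view_scan d).

Definition bit (b : bool) : symbol A := Some (inl b).

(** The shape of [pair_word x w] for a fixed [x] and an unknown [w] in the [pn] cells after the
    separator. Positions are matched against [2 * i] and [(2 * i).+1], as halving is not a term. *)
Definition input_ok (x : seq bool) (n pn c : nat) (a : symbol A) : bool :=
  [&& all (fun i => (c == 2 * i) ==> (a == bit true)) (iota 0 n),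
      all (fun i => (c == (2 * i).+1) ==>
        (nth false x i ==> (a == bit true)) &&
        (~~ nth false x i ==> (a == bit false))) (iota 0 n),
      (c == 2 * n) ==> (a == bit false),
      (2 * n < c) && (c < (2 * n).+1 + pn) ==>
        [|| a == None, a == bit true | a == bit false] &
      ((2 * n).+1 + pn <= c) ==> (a == None)].

(** Here [m] is the number of rows, so the last row has [tau.+1 = m]; acceptance is read there under
    the head. *)
Definition cell_ok (x : seq bool) (n pn m tau c : nat) (d : view) : bool :=
  [&& (c == 0) ==> [forall i, view_right d i == view_scan d i],
      (tau == 0) ==> [&& view_state d == start M, [forall i, view_left d i == None],
        [forall i, (i != ord0) ==> (view_right d i == None)] &
        input_ok x n pn c (view_right d ord0)] &
      (tau.+1 == m) && (c == 0) ==>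
        halting (view_state d) && (view_right d ord0 == bit true)].

(** The three clauses make the cells of a row share one state and one tuple of scanned symbols,
    enforce a step between consecutive rows, and keep the guessed certificate free of inner
    blanks. *)
Definition cells_ok (n tau c tau' c' : nat) (d d' : view) : bool :=
  [&& (tau == tau') ==> (view_state d == view_state d') && (view_scan d == view_scan d'),
      (tau' == tau.+1) ==> (view_state d' == (action d).1) &&
        all (fun i => move_ok ((action d).2 i) c c' (view_left d i) (view_right d i)
                        (view_left d' i) (view_right d' i)) (enum tapes) &
      [&& tau == 0, tau' == 0, 2 * n < c & c' == c.+1] ==>
        ((view_right d ord0 == None) ==> (view_right d' ord0 == None))].

Definition view_of (c : config M) (j : nat) : view :=
  (c.1, [ffun i => scan (c.2 i)], [ffun i => (left_cell (c.2 i) j, right_cell (c.2 i) j)]).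

Lemma step_view (c : config M) j :
  (step c).1 = (action (view_of c j)).1 /\
  forall i c', left_cell ((step c).2 i) c' =
      left_cell (write_move (c.2 i) ((action (view_of c j)).2 i)) c' /\
    right_cell ((step c).2 i) c' =
      right_cell (write_move (c.2 i) ((action (view_of c j)).2 i)) c'.
Proof.
case: c => q ts; rewrite /step /action /view_state /view_scan /=.
case: ifP => _ /=.
  split=> // i c'; rewrite !ffunE /left_cell /right_cell; split=> //=.
  by case: (ts i) => l [|a r] //; case: c' => //= c'; rewrite nth_nil.
case: (transition _ _) => q' acts /=; split=> // i c'.
by rewrite ffunE.
Qed.

Definition accepting (c : config M) :=
  halting c.1 /\ right_cell (c.2 ord0) 0 = bit true.

Variables (x : seq bool) (pn m : nat).
Let n := size x.
Hypothesis m_large : (2 * n).+1 + pn <= m.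

Let X : finType := ('I_m.+1 * 'I_m.+1)%type.
Definition tab_conf (p p' : X) (d d' : view) :=
  ~~ cells_ok n p.1 p.2 p'.1 p'.2 d d'.
Definition tab_bad (p : X) (d : view) := ~~ cell_ok x n pn m.+1 p.1 p.2 d.

Lemma run_tableau w : size w <= pn ->
  accepting (iter m (@step M) (initial M (pair_word x w))) ->
  exists f : X -> view, solution tab_conf tab_bad f.
Proof.
move=> le_w [acc1 acc2]; pose cfg tau := iter tau (@step M) (initial M (pair_word x w)).
have r0 c : right_cell ((cfg 0).2 ord0) c =
    if c < size (pair_word x w) then bit (nth false (pair_word x w) c) else None.
  rewrite /right_cell /= ffunE /=; case: ltnP => lt_c.
    by rewrite (nth_map false).
  by rewrite nth_default // size_map.
have sz := size_pair_word x w.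
exists (fun p : X => view_of (cfg p.1) p.2); split=> [[tau c]|[tau c] [tau' c'] _].
  rewrite /tab_bad negbK /=; apply/and3P; split; apply/implyP.
  - by move/eqP=> ->; apply/forallP => i; rewrite /view_right /view_scan /= !ffunE.
  - move/eqP=> ->; apply/and4P; split.
    + by rewrite /view_state.
    + by apply/forallP => i; rewrite /view_left /= !ffunE /left_cell /= nth_nil.
    + apply/forallP => i; apply/implyP => /negPf i0.
      by rewrite /view_right /= !ffunE /right_cell /= i0 nth_nil.
    + rewrite /view_right /= ffunE r0; apply/and5P; split.
      * apply/allP => i; rewrite mem_iota => /andP[_ lt_i]; apply/implyP => /eqP ->.
        by rewrite nth_pair_word_even // ifT // sz; rewrite /n in lt_i; lia.
      * apply/allP => i; rewrite mem_iota => /andP[_ lt_i]; apply/implyP => /eqP ->.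
        rewrite nth_pair_word_odd // ifT; last by rewrite sz; rewrite /n in lt_i; lia.
        by case: (nth _ _ _); rewrite /= ?eqxx.
      * apply/implyP => /eqP ->; rewrite nth_pair_word_sep ifT //.
        by rewrite sz /n; lia.
      * apply/implyP => _; case: ifP => // _; case: (nth _ _ _); rewrite eqxx ?orbT //.
      * by apply/implyP => le_c; rewrite ifF // sz; apply/negbTE; rewrite -leqNgt;
          rewrite /n in le_c; lia.
  - case/andP=> /eqP [->] /eqP ->; rewrite /view_state /view_right /= acc1 ffunE.
    by rewrite /= acc2 /=.
rewrite /tab_conf negbK /=; apply/and3P; split; apply/implyP.
- by move/eqP=> ->; rewrite /view_state /view_scan /= !eqxx.
- move/eqP=> ->; have [q' cells] := step_view (cfg tau) c.
  rewrite {1}/view_state /= q' eqxx; apply/allP => i _.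
  rewrite /view_left /view_right /= !ffunE.
  have [-> ->] := cells i c'; exact: move_ok_write.
- case/and4P=> /eqP -> /eqP -> lt_c /eqP ->; apply/implyP.
  have vr c1 : view_right (view_of (cfg 0) c1) ord0 = right_cell ((cfg 0).2 ord0) c1.
    by rewrite /view_right ffunE.
  rewrite !vr !r0; case: ltnP => // le_c _.
  by rewrite ifF //; apply/negbTE; rewrite -leqNgt leqW.
Qed.

Lemma tableau_run (f : X -> view) : solution tab_conf tab_bad f ->
  exists2 w, size w <= pn & accepting (iter m (@step M) (initial M (pair_word x w))).
Proof.
move=> [fbad fconf]; pose g tau c := f (inord tau, inord c).
have gcell tau c : tau <= m -> c <= m -> cell_ok x n pn m.+1 tau c (g tau c).
  move=> le_t le_c; have := fbad (inord tau, inord c).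
  by rewrite /tab_bad negbK /= !inordK.
have gcells tau c tau' c' : tau <= m -> c <= m -> tau' <= m -> c' <= m ->
    (tau, c) != (tau', c') -> cells_ok n tau c tau' c' (g tau c) (g tau' c').
  move=> le_t le_c le_t' le_c' neq.
  have := fconf (inord tau, inord c) (inord tau', inord c').
  rewrite /tab_conf negbK /= !inordK //; apply; apply: contra neq => /eqP[e1 e2].
  by rewrite -(inordK (le_t : tau < m.+1)) e1 -(inordK (le_c : c < m.+1)) e2 !inordK.
pose l := [seq view_right (g 0 ((2 * n).+1 + j)) ord0 | j <- iota 0 pn].
have nth_l j : j < pn -> nth None l j = view_right (g 0 ((2 * n).+1 + j)) ord0.
  by move=> lt_j; rewrite (nth_map 0) ?size_iota // nth_iota.
have sz_l : size l = pn by rewrite size_map size_iota.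
have input c : c <= m -> input_ok x n pn c (view_right (g 0 c) ord0).
  by move=> le_c; have /and3P[_ /and4P[]] := gcell 0 c (leq0n _) le_c.
have lb := @leading_bits_closed _ l; rewrite sz_l in lb.
have {lb} lb j : nth None l j = nth None [seq bit b | b <- leading_bits l] j.
  apply: lb => [i lt_i|i lt_i].
    rewrite nth_l //; have /input /and5P[_ _ _ /implyP H _] : (2 * n).+1 + i <= m by lia.
    have {}H := H ltac:(lia).
    by case/or3P: H => /eqP ->; [left | right; exists true | right; exists false].
  rewrite !nth_l //; last by lia.
  have neq : (0, (2 * n).+1 + i) != (0, (2 * n).+1 + i.+1) by apply/eqP => -[]; lia.
  have /and3P[_ _ /implyP H] := gcells 0 ((2 * n).+1 + i) 0 ((2 * n).+1 + i.+1)
    (leq0n m) ltac:(lia) (leq0n m) ltac:(lia) neq.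
  have /implyP {}H := H ltac:(lia).
  by move/eqP => E; apply/eqP; apply: H.
pose w := leading_bits l.
exists w; first by rewrite -sz_l; apply: size_leading_bits.
have cert c : c <= m -> view_right (g 0 c) ord0 =
    if c < size (pair_word x w) then bit (nth false (pair_word x w) c) else None.
  move=> le_c; have /and5P[/allP even /allP odd /implyP sep _ /implyP blank] := input c le_c.
  rewrite size_pair_word; case: (ltnP c (2 * n)) => [lt_c|].
    rewrite ifT; last by rewrite -/n; lia.
    have lt_h : c./2 < n by lia.
    have mem_h : c./2 \in iota 0 n by rewrite mem_iota.
    have := odd_double_half c; rewrite -mul2n.
    case: (boolP (ssrnat.odd c)) => /= odd_c Ec.
      have /implyP/(_ ltac:(lia)) /andP[/implyP H1 /implyP H2] := odd _ mem_h.
      have -> : c = (2 * c./2).+1 by lia.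
      rewrite nth_pair_word_odd //.
      case: (boolP (nth false x c./2)) => [/H1|/H2] /eqP;
        rewrite /= {1}(_ : (2 * c./2).+1 = c) //; lia.
    have /implyP/(_ ltac:(lia)) /eqP := even _ mem_h.
    by move=> ->; rewrite -[X in nth _ _ X]Ec nth_pair_word_even.
  rewrite leq_eqVlt => /orP[/eqP Ec|lt_c].
    rewrite -Ec nth_pair_word_sep ifT; last by rewrite -/n; lia.
    by rewrite Ec; apply/eqP; apply: sep; rewrite Ec.
  have Ec : (2 * n).+1 + (c - (2 * n).+1) = c by lia.
  set j := c - (2 * n).+1 in Ec.
  have -> : (c < 2 * size x + (size w).+1) = (j < size w) by rewrite -/n; lia.
  have -> : view_right (g 0 c) ord0 = nth None l j.
    case: (ltnP j pn) => lt_j; first by rewrite nth_l // Ec.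
    by rewrite nth_default ?sz_l //; apply/eqP; apply: blank; lia.
  rewrite lb -Ec nth_pair_word_cert; case: ltnP => le_j.
    by rewrite (nth_map false).
  by rewrite nth_default // size_map.
pose cfg tau := iter tau (@step M) (initial M (pair_word x w)).
(* Cell [c] of a row depends on cell [c.+1] of the row before, and there is no column beyond [m]. So
   one column is lost per step; a square table still determines the scanned cell of the last row. *)
have agree tau c : tau + c <= m -> g tau c = view_of (cfg tau) c.
  elim: tau c => [|tau IH] c le_c.
    have init_right i c' : c' <= m -> view_right (g 0 c') i = right_cell ((cfg 0).2 i) c'.
      move=> le_c'; rewrite /right_cell /= ffunE /=; case: (eqVneq i ord0) => [->|i0].
        rewrite cert //; case: ltnP => lt_c; first by rewrite (nth_map false).
        by rewrite nth_default // size_map.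
      have /and3P[_ /and4P[_ _ /forallP /(_ i)]] := gcell 0 c' (leq0n _) le_c'.
      by rewrite i0 nth_nil => /eqP.
    have /and3P[_ /and4P[/eqP Eq /forallP El _ _] _] := gcell 0 c (leq0n _) le_c.
    (* The recorded scanned symbols are tied to actual cells only in column 0, so the other columns
       are compared with that one. *)
    have scan0 i : view_scan (g 0 c) i = scan ((cfg 0).2 i).
      have -> : view_scan (g 0 c) = view_scan (g 0 0).
        case: (eqVneq c 0) => [-> //|c0].
        have neq : (0, c) != (0, 0) by apply/eqP => -[/eqP]; apply/negP.
        by have /and3P[/andP[_ /eqP]] := gcells _ _ _ _ (leq0n m) le_c (leq0n m) (leq0n m) neq.
      have /and3P[/forallP /(_ i) /eqP <- _ _] := gcell 0 0 (leq0n _) (leq0n _).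
      by rewrite init_right.
    case: (g 0 c) Eq El scan0 (init_right^~ c) => [[q s] cells] /= Eq El scan0 right0.
    rewrite /view_of; congr (_, _, _); first exact: Eq.
      by apply/ffunP => i; rewrite ffunE -scan0.
    apply/ffunP => i; rewrite ffunE -right0 // [cells i]surjective_pairing.
    congr (_, _); have /eqP := El i; rewrite /view_left /= => ->.
    by rewrite /= ffunE /left_cell nth_nil.
  have stepc c' : tau.+1 + c' <= m ->
      view_state (g tau.+1 c') = (cfg tau.+1).1 /\
      forall i, view_left (g tau.+1 c') i = left_cell ((cfg tau.+1).2 i) c' /\
                view_right (g tau.+1 c') i = right_cell ((cfg tau.+1).2 i) c'.
    move=> le_c'; have [q' cells] := step_view (cfg tau) c'.
    have rel c'' : c'' <= c'.+1 ->
        cells_ok n tau c'' tau.+1 c' (view_of (cfg tau) c'') (g tau.+1 c').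
      move=> le_c''; rewrite -IH; last by lia.
      by apply: gcells; try lia; apply/eqP => -[]; lia.
    have act_eq c'' : action (view_of (cfg tau) c'') = action (view_of (cfg tau) c') by [].
    split.
      have /and3P[_ /implyP /(_ (eqxx _)) /andP[/eqP -> _] _] := rel c' (leqnSn _).
      by rewrite -q'.
    move=> i; have [/= -> ->] := cells i c'.
    apply: move_ok_det => c'' _ le_c''.
    have /and3P[_ /implyP /(_ (eqxx _)) /andP[_ /allP H] _] := rel c'' le_c''.
    have i_enum : i \in enum tapes by rewrite mem_enum.
    by have := H i i_enum; rewrite act_eq /view_left /view_right /= !ffunE.
  have [Eq Ecells] := stepc c le_c.
  have scanS i : view_scan (g tau.+1 c) i = scan ((cfg tau.+1).2 i).
    have -> : view_scan (g tau.+1 c) = view_scan (g tau.+1 0).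
      case: (eqVneq c 0) => [-> //|c0].
      have neq : (tau.+1, c) != (tau.+1, 0) by apply/eqP => -[/eqP]; apply/negP.
      have /and3P[] := gcells tau.+1 c tau.+1 0 ltac:(lia) ltac:(lia) ltac:(lia) (leq0n m) neq.
      by rewrite eqxx /= => /andP[_ /eqP].
    have /and3P[/forallP /(_ i) /eqP <- _ _] := gcell tau.+1 0 ltac:(lia) (leq0n _).
    have [_ /(_ i) [_ ->]] := stepc 0 ltac:(lia).
    by [].
  case: (g tau.+1 c) Eq Ecells scanS => [[q s] cells] /= Eq Ecells scanS.
  rewrite /view_of; congr (_, _, _); first exact: Eq.
    by apply/ffunP => i; rewrite ffunE -scanS.
  apply/ffunP => i; rewrite ffunE [cells i]surjective_pairing.
  by have [/= <- <-] := Ecells i.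
have /and3P[_ _ /implyP acc] := gcell m 0 (leqnn _) (leq0n _).
have {acc} /andP[acc1 /eqP acc2] := acc ltac:(by rewrite !eqxx).
move: acc1 acc2; rewrite agree ?addn0 //.
by rewrite /view_state /view_right /= ffunE.
Qed.

End Tableau.

(** * NP-hardness *)

Lemma separator_iso (T T' : finType) (e : rel T) (e' : rel T') (h : T -> T') (g : T' -> T)
    (u v : T) (S : {set T}) :
  cancel h g -> cancel g h -> (forall a b, e' (h a) (h b) = e a b) ->
  separator e u v S ->
  separator e' (h u) (h v) (g @^-1: S) /\ alpha e' (g @^-1: S) <= alpha e S.
Proof.
move=> hK gK hom [uS vS nopath].
have hom' a b : e' a b = e (g a) (g b) by rewrite -hom !gK.
split.
  split; rewrite ?inE ?hK // => -[p [ep lp up pS]]; apply: nopath.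
  exists (map g p); split.
  - by rewrite -[u]hK path_map; rewrite -(eq_path hom').
  - by rewrite -[u]hK last_map lp hK.
  - by rewrite -[u]hK -map_cons map_inj_uniq //; apply: can_inj gK.
  - move=> a; rewrite -[u]hK -map_cons => /mapP[b bp ->].
    by have := pS b bp; rewrite inE.
apply/bigmax_leqP => I /andP[sIS indI].
rewrite -(card_imset I (can_inj gK)).
apply: (leq_bigmax_cond (P := fun J : {set T} => (J \subset S) && independent e J)
  (F := fun J : {set T} => #|J|)).
apply/andP; split.
  apply/subsetP => _ /imsetP[a aI ->].
  by have := subsetP sIS a aI; rewrite inE.
apply/forall_inP => _ /imsetP[a aI ->]; apply/forall_inP => _ /imsetP[b bI ->].
by rewrite -hom'; have /forall_inP /(_ a aI) /forall_inP := indI; apply.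
Qed.

Lemma mulnD_inj n a b a' b' : b < n -> b' < n ->
  a * n + b = a' * n + b' -> a = a' /\ b = b'.
Proof.
move=> lt_b lt_b' E; have n0 : 0 < n by case: n lt_b {lt_b' E}.
have := congr1 (divn^~ n) E; have := congr1 (modn^~ n) E.
by rewrite !modnMDl !divnMDl // !modn_small // !divn_small // !addn0.
Qed.

Lemma mulnD_ltn m n a b : a < m -> b < n -> a * n + b < m * n.
Proof.
move=> lt_a lt_b; apply: (@leq_trans (a.+1 * n)); last by rewrite leq_mul2r lt_a orbT.
by rewrite mulSn addnC ltn_add2r.
Qed.

(** Only the positions of the bits [true] are described. The row and column of a matrix entry are
    searched for instead of being computed by division. *)
Definition word_bit (N : nat) (E : nat -> nat -> bool) (cu cv j : nat) : bool :=
  [|| j < N,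
      has (fun a => has (fun b => (j == N.+1 + (a * N + b)) && E a b) (iota 0 N)) (iota 0 N),
      (N.+1 + N * N <= j) && (j < N.+1 + N * N + cu) |
      (N.+1 + N * N + cu.+1 <= j) && (j < N.+1 + N * N + cu.+1 + cv)].

Lemma word_bitE N (E : nat -> nat -> bool) (e : rel 'I_N) (u v : 'I_N) :
  (forall a b, e a b = E a b) ->
  mkseq (word_bit N E u v) (N.+1 + N * N + (u.+1 + v.+1)) = instance_word e u v.
Proof.
move=> eE; have mat j : has (fun a => has (fun b => (j == N.+1 + (a * N + b)) && E a b)
    (iota 0 N)) (iota 0 N) -> N.+1 <= j < N.+1 + N * N.
  case/hasP=> a; rewrite mem_iota => /andP[_ lt_a] /hasP[b].
  rewrite mem_iota => /andP[_ lt_b] /andP[/eqP -> _].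
  have := leq_mul lt_a (leqnn N); lia.
apply: instance_word_eq.
- by rewrite size_mkseq.
- by move=> i lt_i; rewrite nth_mkseq /word_bit ?lt_i //; lia.
- rewrite nth_mkseq /word_bit; last by lia.
  apply/negP => /or4P[|/mat|/andP[]|/andP[]]; lia.
- move=> i j; have := leq_mul (ltn_ord i) (leqnn N); have := ltn_ord j => lt_j lt_i.
  rewrite nth_mkseq /word_bit; last by lia.
  apply/or4P/idP => [[|/hasP[a _ /hasP[b]]|/andP[]|/andP[]]|eij]; try lia.
    rewrite mem_iota => /andP[_ lt_b] /andP[/eqP /addnI Eij Eab].
    have [ea eb] := mulnD_inj lt_j lt_b Eij.
    by rewrite eE ea eb.
  constructor 2; apply/hasP; exists (i : nat); first by rewrite mem_iota ltn_ord.
  apply/hasP; exists (j : nat); first by rewrite mem_iota ltn_ord.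
  by rewrite eqxx -eE.
- move=> i le_i; rewrite nth_mkseq /word_bit; last by lia.
  apply/or4P/idP => [[|/mat|/andP[]|/andP[]]|lt_i]; try lia.
  by constructor 3; lia.
- move=> i le_i; rewrite nth_mkseq /word_bit; last by lia.
  apply/or4P/idP => [[|/mat|/andP[]|/andP[]]|lt_i]; try lia.
  by constructor 4; lia.
Qed.

Lemma defb_part_adj (D : finType) k (eqx zl zr : seq bool -> seq nat -> bool)
    (cf cf' : D -> D -> seq bool -> seq nat -> bool) (bl br : D -> seq bool -> seq nat -> bool)
    (q q' : gadget_part D k) :
  defb eqx -> defb zl -> defb zr -> (forall d d', defb (cf d d')) ->
  (forall d d', defb (cf' d d')) -> (forall d, defb (bl d)) -> (forall d, defb (br d)) ->
  defb (fun x e => part_adj (eqx x e) (zl x e) (zr x e) (fun d d' => cf d d' x e)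
    (fun d d' => cf' d d' x e) (fun d => bl d x e) (fun d => br d x e) q q').
Proof.
move=> Heq Hzl Hzr Hcf Hcf' Hbl Hbr.
case: q => [[[d r] s]|[b|i]]; case: q' => [[[d' r'] s']|[b'|i']];
  rewrite /part_adj /special_adj /elt_conflict /elt_disabled /=;
  try (case: (s)); try (case: (s'));
  repeat first [apply: Heq | apply: Hzl | apply: Hzr | apply: Hcf | apply: Hcf'
    | apply: Hbl | apply: Hbr | defb_step].
Qed.

Section Reduction.
Variables (k : nat) (M : machine) (p pM : {poly nat}).

Let part := gadget_part (view M) k.
Definition red_guess (x : seq bool) : nat := p.[size x]%R.
Definition red_len (x : seq bool) : nat := (2 * size x).+1 + red_guess x.
(** One number for both dimensions of the table: enough steps for every certificate of allowed
    length, and enough columns for the whole input. *)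
Definition red_m (x : seq bool) : nat := pM.[red_len x]%R + red_len x.
Definition red_conf (x : seq bool) tau c tau' c' (d d' : view M) : bool :=
  ~~ cells_ok (size x) tau c tau' c' d d'.
Definition red_bad (x : seq bool) tau c (d : view M) : bool :=
  ~~ cell_ok x (size x) (red_guess x) (red_m x).+1 tau c d.
(** A mixed-radix numbering. The terminals are attached to the variable [(0, 0)], so their numbers
    do not depend on [x]. *)
Definition red_index (x : seq bool) tau c (q : part) : nat :=
  (tau * (red_m x).+1 + c) * #|{: part}| + enum_rank q.
Definition red_adj (x : seq bool) tau c tau' c' (q q' : part) : bool :=
  part_adj ((tau == tau') && (c == c')) ((tau == 0) && (c == 0))
    ((tau' == 0) && (c' == 0)) (red_conf x tau c tau' c') (red_conf x tau' c' tau c)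
    (red_bad x tau c) (red_bad x tau' c') q q'.
Definition red_edge (x : seq bool) (a b : nat) : bool :=
  let m := (red_m x).+1 in
  has (fun tau => has (fun c => has (fun tau' => has (fun c' =>
    has (fun q => has (fun q' =>
      [&& a == red_index x tau c q, b == red_index x tau' c' q' &
        red_adj x tau c tau' c' q q'])
    (enum {: part})) (enum {: part}))
    (iota 0 m)) (iota 0 m)) (iota 0 m)) (iota 0 m).
Definition red_order (x : seq bool) := (red_m x).+1 * (red_m x).+1 * #|{: part}|.
Definition red_terminal b : part := inr (inl b).
Definition red_word (x : seq bool) : seq bool :=
  let cu := enum_rank (red_terminal true) in
  let cv := enum_rank (red_terminal false) in
  mkseq (word_bit (red_order x) (red_edge x) cu cv)
    ((red_order x).+1 + red_order x * red_order x + (cu.+1 + cv.+1)).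

Lemma red_poly_time : poly_time_computable red_word.
Proof.
have Hg : deft (fun x _ => red_guess x) by apply: deft_poly; apply: deft_size.
have Hl : deft (fun x _ => red_len x) by rewrite /red_len; definability.
have Hm : deft (fun x _ => red_m x).
  by rewrite /red_m; apply: deft_add => //; apply: deft_poly.
have HN : deft (fun x _ => red_order x) by rewrite /red_order; definability.
have Hconf g1 g2 g3 g4 d d' : deft g1 -> deft g2 -> deft g3 -> deft g4 ->
    defb (fun x e => red_conf x (g1 x e) (g2 x e) (g3 x e) (g4 x e) d d').
  move=> H1 H2 H3 H4; rewrite /red_conf /cells_ok; definability.
  (* The view [d] is a constant of the formula, so the direction of the move is settled by cases
     outside it. *)
  rewrite /move_ok; case: ((action d).2 _) => a [] /=; definability.
have Hbad g1 g2 d : deft g1 -> deft g2 ->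
    defb (fun x e => red_bad x (g1 x e) (g2 x e) d).
  by move=> H1 H2; rewrite /red_bad /cell_ok /input_ok; definability.
apply: (@def_poly_time_computable (fun x => (red_order x).+1 + red_order x * red_order x +
  ((enum_rank (red_terminal true)).+1 + (enum_rank (red_terminal false)).+1))
  (fun x => word_bit (red_order x) (red_edge x) (enum_rank (red_terminal true))
    (enum_rank (red_terminal false)))); first by definability.
rewrite /word_bit /red_edge /red_index; definability.
rewrite /red_adj; apply: defb_part_adj; try move=> ?; try move=> ?; cbv beta;
  repeat first [apply: Hconf | apply: Hbad | deft_step | defb_step].
Qed.

Variable V : pred (seq bool).
Hypothesis M_decides : forall y, outputs_within M y pM.[size y]%R [:: V y].

(** Halting configurations are fixed and [pM] is monotone, so the common number of steps [red_m x]
    serves every word of allowed length. *)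
Lemma accepting_decides x y : size y <= red_len x ->
  accepting (iter (red_m x) (@step M) (initial M y)) <-> V y.
Proof.
move=> le_y; have [halt out] := M_decides y.
have le_t : pM.[size y]%R <= red_m x.
  by rewrite (leq_trans (leq_horner pM le_y)) // leq_addr.
have -> : iter (red_m x) (@step M) (initial M y) =
    iter pM.[size y]%R (@step M) (initial M y).
  rewrite -(subnK le_t) iterD; move: (iter pM.[size y]%R _ _) halt => c halt.
  elim: (_ - _) => //= j ->; case: c halt => q ts /= halt.
  by rewrite /step halt.
rewrite /accepting /right_cell.
move: out; case: (after _) => [|[[b|a]|] l] //= [-> _].
by split=> [[_ []]|->].
Qed.

Lemma red_correct (hk : 3 <= k) x :
  (exists w, size w <= p.[size x]%R /\ V (pair_word x w)) <->
  small_alpha_separator k (red_word x).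
Proof.
pose m := red_m x; pose X : finType := ('I_m.+1 * 'I_m.+1)%type.
pose x0 : X := (ord0, ord0).
have m_large : (2 * size x).+1 + red_guess x <= m by apply: leq_addl.
pose conf : X -> X -> view M -> view M -> bool := @tab_conf M x m.
pose bad : X -> view M -> bool := @tab_bad M x (red_guess x) m.
pose e : rel (X * part)%type := @gadget _ k _ x0 conf bad.
have step1 : (exists w, size w <= p.[size x]%R /\ V (pair_word x w)) <->
    exists f, solution conf bad f.
  have szy w : size w <= p.[size x]%R -> size (pair_word x w) <= red_len x.
    by rewrite size_pair_word /red_len /red_guess; lia.
  split=> [[w [le_w Vw]]|[f /(tableau_run m_large) [w le_w acc]]].
    apply: (run_tableau m_large le_w).
    by apply/(accepting_decides (szy _ le_w)).
  by exists w; split=> //; apply/(accepting_decides (szy _ le_w)).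
pose N := red_order x; pose T : finType := (X * part)%type.
have lt_h (t : T) : red_index x t.1.1 t.1.2 t.2 < N.
  by apply: mulnD_ltn => //; apply: mulnD_ltn.
pose h (t : T) : 'I_N := Ordinal (lt_h t).
have index_inj tau c q tau' c' q' : c <= m -> c' <= m ->
    red_index x tau c q = red_index x tau' c' q' -> [/\ tau = tau', c = c' & q = q'].
  move=> le_c le_c' /mulnD_inj [] // /mulnD_inj [] // -> -> /ord_inj /enum_rank_inj ->.
  by [].
have h_inj : injective h.
  move=> [[tau c] q] [[tau' c'] q'] /(congr1 val) /index_inj [].
  - by rewrite -ltnS.
  - by rewrite -ltnS.
  - by move=> /= /ord_inj -> /ord_inj -> ->.
have [g hK gK] : bijective h.
  by apply: inj_card_bij h_inj _; rewrite card_ord !card_prod !card_ord.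
pose e' : rel 'I_N := [rel a b | e (g a) (g b)].
have hom a b : e' (h a) (h b) = e a b by rewrite -[in RHS](hK a) -[in RHS](hK b).
have hom' a b : e (g a) (g b) = e' a b by [].
have adjE (t t' : T) :
    red_adj x t.1.1 t.1.2 t'.1.1 t'.1.2 t.2 t'.2 = e t t'.
  by case: t => [[tau c] q]; case: t' => [[tau' c'] q'].
have e'E (a b : 'I_N) : e' a b = red_edge x a b.
  rewrite -[a]gK -[b]gK hom -adjE.
  move: (g a) (g b) => {a b} [[tau c] q] [[tau' c'] q'] /=.
  have in_m (i : 'I_m.+1) : (i : nat) \in iota 0 m.+1 by rewrite mem_iota ltn_ord.
  have in_q q1 : q1 \in enum {: part} by rewrite mem_enum.
  apply/idP/idP => [adj|].
    apply/hasP; exists (tau : nat) => //; apply/hasP; exists (c : nat) => //.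
    apply/hasP; exists (tau' : nat) => //; apply/hasP; exists (c' : nat) => //.
    apply/hasP; exists q => //; apply/hasP; exists q' => //.
    by rewrite !eqxx.
  case/hasP=> t1 _ /hasP[c1 c1m] /hasP[t2 _ /hasP[c2 c2m]].
  case/hasP=> q1 _ /hasP[q2 _] /and3P[/eqP E1 /eqP E2].
  move: c1m c2m; rewrite !mem_iota !ltnS => /= le1 le2.
  have [<- <- <-] := index_inj _ _ _ _ _ _ (ltn_ord c : c <= m) le1 E1.
  by have [<- <- <-] := index_inj _ _ _ _ _ _ (ltn_ord c' : c' <= m) le2 E2.
pose u := h (terminal (view M) k x0 true); pose v := h (terminal (view M) k x0 false).
have wordE : red_word x = instance_word e' u v.
  rewrite -(word_bitE u v e'E) /red_word.
  by rewrite /u /v /= /red_index /= !mul0n !add0n.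
have [e_sym e_irr] := gadget_simple k x0 conf bad.
have e'_simple : simple_graph e'.
  by split=> [a b|a]; rewrite /e' /=; [apply: e_sym | apply: e_irr].
have uv : u != v by apply/eqP => /h_inj.
rewrite step1; split.
  case=> f /(@solution_separator _ k _ x0 conf bad hk) [S [sepS leS]].
  have [sepS' leS'] := separator_iso hK gK hom sepS.
  exists N, e', u, v; split=> //; exists (g @^-1: S); split=> //.
  exact: leq_trans leS' leS.
case=> N' [e1 [u1 [v1 [_ _ E1 [S [sepS leS]]]]]].
(* An instance word determines its graph and terminals, so the instance that witnesses membership is
   the constructed one. *)
rewrite wordE in E1; have EN := instance_word_size_inj E1; subst N'.
have [ee eu ev] := instance_word_inj E1.
have {ee} ee : e' = e1.
  by apply: functional_extensionality => a; apply: functional_extensionality => b.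
subst e1 u1 v1.
have [sepS' leS'] := separator_iso gK hK hom' sepS.
rewrite /u /v !hK in sepS'.
apply: (separator_solution hk _ sepS' (leq_trans leS' leS)).
exact: (start M, [ffun=> None], [ffun=> (None, None)]).
Qed.

End Reduction.

Theorem small_alpha_separator_NP_hard k : 3 <= k -> NP_hard (small_alpha_separator k).
Proof.
move=> hk L [V [p [[M [pM M_decides]] LE]]].
exists (@red_word k M p pM); split; first exact: red_poly_time.
by move=> x; rewrite LE; apply: red_correct.
Qed.

(** * Membership in NP *)

Definition inst_bit (y : seq bool) i := nth false y (2 * i).+1.
Definition cert_bit (y : seq bool) s i := nth false y ((2 * s).+1 + i).
Definition inst_edge y n a b := inst_bit y (n.+1 + (a * n + b)).

Definition indep_list y n s l :=
  all (cert_bit y s) l && pairwise (fun a b => (a != b) && ~~ inst_edge y n a b) l.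

(** For a fixed [j] this unfolds to [j] nested bounded quantifiers, hence to a single formula; the
    list [l] collects the variables already bound. *)
Fixpoint no_indep_list y n s j l :=
  if j is j'.+1 then all (fun a => no_indep_list y n s j' (a :: l)) (iota 0 n)
  else ~~ indep_list y n s l.

Definition valid_word y s n u v :=
  [&& s == n.+1 + n * n + (u.+1 + v.+1),
      all (fun i => inst_bit y i) (iota 0 n), ~~ inst_bit y n,
      all (fun i => inst_bit y (n.+1 + n * n + i)) (iota 0 u),
      ~~ inst_bit y (n.+1 + n * n + u),
      all (fun i => inst_bit y (n.+1 + n * n + u.+1 + i)) (iota 0 v) &
      ~~ inst_bit y (n.+1 + n * n + u.+1 + v)].

Definition valid_graph y n (u v : nat) :=
  [&& all (fun a => all (fun b => inst_edge y n a b ==> inst_edge y n b a) (iota 0 n))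
        (iota 0 n),
      all (fun a => ~~ inst_edge y n a a) (iota 0 n) & u != v].

(* The certificate lists the separator and the side of [u]. *)
Definition valid_separator y s n u v :=
  [&& ~~ cert_bit y s u, ~~ cert_bit y s v, cert_bit y s (n + u),
      ~~ cert_bit y s (n + v) &
      all (fun a => all (fun b => cert_bit y s (n + a) && inst_edge y n a b ==>
         cert_bit y s (n + b) || cert_bit y s b) (iota 0 n)) (iota 0 n)].

(** The numbers [s], [n], [u] and [v] are found by bounded search. The test on the even positions
    pins [s] down to the size of the first component of the pair. *)
Definition verifier k y :=
  has (fun s =>
    [&& all (fun i => nth false y (2 * i)) (iota 0 s), ~~ nth false y (2 * s) &
      has (fun n => has (fun u => has (fun v =>
        [&& valid_word y s n u v, valid_graph y n u v, valid_separator y s n u v &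
            no_indep_list y n s k.+1 [::]])
      (iota 0 n)) (iota 0 n)) (iota 0 s)])
  (iota 0 (size y)).

Definition all_deft (gs : seq (seq bool -> seq nat -> nat)) :=
  foldr (fun g P => deft g /\ P) True gs.

Lemma all_deft_behead gs : all_deft gs ->
  all_deft [seq (fun x e => g x (behead e)) | g <- gs].
Proof.
by elim: gs => //= g gs IH [dg /IH dgs]; split=> //; apply: (deft_weak 1 dg).
Qed.

(** The list of vertices is given by a list of definable terms, which makes the induction possible:
    each quantifier adds a variable to it and shifts the other terms. *)
Lemma defb_no_indep_list j ns ss gs : deft ns -> deft ss -> all_deft gs ->
  defb (fun y e => no_indep_list y (ns y e) (ss y e) j [seq g y e | g <- gs]).
Proof.
elim: j ns ss gs => [|j IH] ns ss gs dn ds dgs /=.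
  apply: defb_not; apply: defb_and.
    elim: gs dgs => [|g gs IH] /=; first by move=> _; apply: defb_cst.
    case=> dg dgs; apply: defb_and (IH dgs).
    by rewrite /cert_bit; definability.
  elim: gs dgs => [|g gs IH] /=; first by move=> _; apply: defb_cst.
  case=> dg dgs; apply: defb_and (IH dgs).
  elim: gs dgs {IH} => [|g' gs IH] /=; first by move=> _; apply: defb_cst.
  case=> dg' dgs; apply: defb_and (IH dgs).
  by rewrite /inst_edge /inst_bit; definability.
apply: defb_all => //.
have dhead : deft (fun _ e => head 0 e) := deft_var 0.
have /= dP := IH (fun x e => ns x (behead e)) (fun x e => ss x (behead e))
  ((fun _ e => head 0 e) :: [seq (fun x e => g x (behead e)) | g <- gs])
  (deft_weak 1 dn) (deft_weak 1 ds) (conj dhead (all_deft_behead dgs)).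
by apply: defb_ext dP _ => x e; rewrite -map_comp.
Qed.

Lemma verifier_poly_time k : poly_time_decidable (verifier k).
Proof.
apply: def_poly_time_decidable.
apply: defb_has; first exact: deft_size.
apply: defb_and; first by definability.
apply: defb_and; first by definability.
apply: defb_has; first exact: (deft_var 0).
apply: defb_has; first exact: (deft_var 0).
apply: defb_has; first exact: (deft_var 1).
apply: defb_and; first by rewrite /valid_word /inst_bit; definability.
apply: defb_and; first by rewrite /valid_graph /inst_edge /inst_bit; definability.
apply: defb_and.
  by rewrite /valid_separator /inst_edge /inst_bit /cert_bit; definability.
exact: (@defb_no_indep_list k.+1 _ _ [::] (deft_var 2) (deft_var 3)).
Qed.

(** * Correctness of the verifier *)

Lemma no_indep_listP y n s j l :
  reflect (forall l', size l' = j -> all (gtn n) l' -> ~~ indep_list y n s (catrev l' l))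
    (no_indep_list y n s j l).
Proof.
elim: j l => [|j IH] l /=.
  by apply: (iffP idP) => [ok [|a l']|/(_ [::])] //; apply.
apply: (iffP allP) => [ok [|a l'] //= [sz_l'] /andP[lt_a lt_l']|ok a].
  have am : a \in iota 0 n by rewrite mem_iota.
  exact: (elimT (IH (a :: l)) (ok a am)).
rewrite mem_iota => /andP[_ lt_a]; apply/IH => l' sz_l' lt_l'.
by apply: (ok (a :: l')); rewrite /= ?sz_l' ?lt_l' ?andbT.
Qed.

Lemma verifier_complete k x : small_alpha_separator k x ->
  exists w, size w <= 2 * size x /\ verifier k (pair_word x w).
Proof.
case=> n [e [u [v [[e_sym e_irr] uv def_x [S [sepS leS]]]]]].
have [sz_x x1 x2 [x3 x4 x5]] := instance_wordE def_x.
have [C [uC vC closed]] := separator_component sepS.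
have [uS vS _] := sepS.
(* Two characteristic vectors of length [n], whence the bound [2 * size x] on the certificate. *)
pose w := [seq i \in S | i <- enum 'I_n] ++ [seq i \in C | i <- enum 'I_n].
have sz1 (A : {set 'I_n}) : size [seq i \in A | i <- enum 'I_n] = n.
  by rewrite size_map size_enum_ord.
have nth1 (A : {set 'I_n}) (i : 'I_n) : nth false [seq i \in A | i <- enum 'I_n] i = (i \in A).
  by rewrite (nth_map i) ?size_enum_ord // nth_ord_enum.
exists w; split; first by rewrite size_cat !sz1 sz_x; lia.
set y := pair_word x w.
have wS (i : 'I_n) : cert_bit y (size x) i = (i \in S).
  by rewrite /cert_bit nth_pair_word_cert nth_cat sz1 ltn_ord nth1.
have wC (i : 'I_n) : cert_bit y (size x) (n + i) = (i \in C).
  by rewrite /cert_bit nth_pair_word_cert nth_cat sz1 ltnNge leq_addr addKn nth1.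
have xE i : i < size x -> inst_bit y i = nth false x i by apply: nth_pair_word_odd.
have eE (a b : 'I_n) : inst_edge y n a b = e a b.
  rewrite /inst_edge xE ?x3 // sz_x; have := mulnD_ltn (ltn_ord a) (ltn_ord b); lia.
have iotaP (i : nat) : i \in iota 0 n -> exists a : 'I_n, i = a.
  by rewrite mem_iota => lt_i; exists (Ordinal lt_i).
have iota_ord (i : 'I_n) : (i : nat) \in iota 0 n by rewrite mem_iota ltn_ord.
have lt_u := ltn_ord u; have lt_v := ltn_ord v.
apply/hasP; exists (size x).
  by rewrite mem_iota size_pair_word; lia.
apply/and3P; split.
- by apply/allP => i; rewrite mem_iota => lt_i; apply: nth_pair_word_even.
- by rewrite nth_pair_word_sep.
apply/hasP; exists n; first by rewrite mem_iota sz_x; lia.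
apply/hasP; exists (u : nat) => //; apply/hasP; exists (v : nat) => //.
apply/and4P; split.
- apply/and5P; split; rewrite ?sz_x ?xE //; try lia.
  + apply/allP => i; rewrite mem_iota => /andP[_ lt_i].
    by rewrite xE; [apply: x1 | lia].
  + apply/allP => i; rewrite mem_iota => /andP[_ lt_i].
    by rewrite xE; [rewrite x4 ?lt_i // ltnW | lia].
  + apply/and3P; split; rewrite ?xE ?x4 ?x5 ?ltnn //; try lia.
    apply/allP => i; rewrite mem_iota => /andP[_ lt_i].
    by rewrite xE; [rewrite x5 ?lt_i // ltnW | lia].
- apply/and3P; split=> //.
    apply/allP => _ /iotaP[a ->]; apply/allP => _ /iotaP[b ->].
    by rewrite !eE e_sym implybb.
  by apply/allP => _ /iotaP[a ->]; rewrite eE e_irr.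
- apply/and5P; split; rewrite ?wS ?wC //.
  apply/allP => _ /iotaP[a ->]; apply/allP => _ /iotaP[b ->].
  rewrite !wC wS eE; apply/implyP => /andP[aC ab].
  by have := closed a b aC ab; rewrite inE.
- apply/no_indep_listP => l sz_l lt_l; apply/negP => /andP[lS].
  rewrite catrevE cats0 in lS *; move=> /(pairwiseP 0) lr.
  have {}lt_l a : a \in rev l -> a < n by rewrite mem_rev => /(allP lt_l).
  have {}sz_l : size (rev l) = k.+1 by rewrite size_rev.
  move: (rev l) sz_l lt_l lS lr => {}l sz_l lt_l lS lr.
  pose o (a : nat) : 'I_n := insubd u a.
  have oE a : a \in l -> o a = a :> nat by move=> /lt_l lt_a; rewrite val_insubd lt_a.
  (* [pairwise] compares two entries only in the order of the list; the symmetry of the graph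
     provides the other order below. *)
  have rel a b : a \in l -> b \in l -> a != b ->
      ((a != b) && ~~ inst_edge y n a b) || ((b != a) && ~~ inst_edge y n b a).
    move=> al bl ab; rewrite -(nth_index 0 al) -(nth_index 0 bl).
    have := index_mem a l; have := index_mem b l; rewrite al bl => ib ia.
    case: (ltngtP (index a l) (index b l)) => [lt|lt|E].
    - by rewrite lr.
    - by rewrite orbC lr.
    - by rewrite -(nth_index 0 al) E nth_index ?eqxx in ab.
  have ul : uniq l.
    apply/(uniqP 0) => i j lt_i lt_j Eij; apply/eqP; apply: contraT.
    rewrite neq_ltn => /orP[lt|lt]; first by have := lr i j lt_i lt_j lt; rewrite Eij eqxx.
    by have := lr j i lt_j lt_i lt; rewrite Eij eqxx.
  have := leS; rewrite leqNgt => /negP; apply; rewrite -sz_l -(size_map o).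
  apply: size_leq_alpha.
  + rewrite map_inj_in_uniq // => a b al bl /(congr1 val) /=.
    by rewrite [val _]oE // [val _]oE.
  + move=> _ /mapP[a al ->]; rewrite -wS oE //.
    exact: (allP lS).
  + move=> _ _ /mapP[a al ->] /mapP[b bl ->]; rewrite -eE !oE //.
    case: (eqVneq a b) => [<-|ab].
      by have := e_irr (o a); rewrite -eE oE // => ->.
    have sym : inst_edge y n b a = inst_edge y n a b.
      by rewrite -(oE a) // -(oE b) // !eE.
    by have := rel a b al bl ab; rewrite [b == a]eq_sym sym ab orbb.
Qed.

Lemma verifier_sound k x w : verifier k (pair_word x w) -> small_alpha_separator k x.
Proof.
set y := pair_word x w.
case/hasP=> s _ /and3P[/allP even sep].
(* A smaller [s] would meet a [true] at position [2 * s], and a larger one would require [true] at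
   the separating [false]. *)
have {even sep} -> : s = size x.
  case: (ltngtP s (size x)) => // lt_s.
    by rewrite nth_pair_word_even in sep.
  by have := even (size x); rewrite mem_iota lt_s nth_pair_word_sep => /(_ isT).
case/hasP=> n _ /hasP[u0 + /hasP[v0 +]]; rewrite !mem_iota => lt_u lt_v.
have xE i : i < size x -> inst_bit y i = nth false x i by apply: nth_pair_word_odd.
pose u : 'I_n := Ordinal lt_u; pose v : 'I_n := Ordinal lt_v.
case/and4P=> /and5P[/eqP sz_x /allP x1 x2 /allP x3 /and3P[x4 /allP x5 x6]].
case/and3P=> /allP esym /allP eirr uv sepP /no_indep_listP noind.
pose e : rel 'I_n := [rel a b : 'I_n | inst_edge y n a b].
have iota_ord (i : 'I_n) : (i : nat) \in iota 0 n by rewrite mem_iota ltn_ord.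
have e_sym : symmetric e.
  have imp a b : e a b -> e b a.
    by have /allP /(_ _ (iota_ord b)) /implyP := esym _ (iota_ord a).
  by move=> a b; apply/idP/idP; apply: imp.
have e_irr : irreflexive e.
  by move=> a; apply/negbTE; apply: eirr.
exists n, e, u, v; split=> //.
  apply: instance_word_eq => //=.
  - move=> i lt_i; rewrite -xE; last by lia.
    by apply: x1; rewrite mem_iota.
  - by rewrite -xE //; lia.
  - move=> i j; rewrite -xE //; have := mulnD_ltn (ltn_ord i) (ltn_ord j); lia.
  - move=> i le_i; rewrite -xE; last by lia.
    move: le_i; rewrite leq_eqVlt => /orP[/eqP ->|lt_i]; first by rewrite ltnn; apply/negbTE.
    by rewrite lt_i; apply: x3; rewrite mem_iota.
  - move=> i le_i; rewrite -xE; last by lia.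
    move: le_i; rewrite leq_eqVlt => /orP[/eqP ->|lt_i]; first by rewrite ltnn; apply/negbTE.
    by rewrite lt_i; apply: x5; rewrite mem_iota.
pose S := [set i : 'I_n | cert_bit y (size x) i].
exists S; case/and5P: sepP => uS vS uC vC /allP closed; split.
  apply: (@separator_closed _ _ _ _ S [set i : 'I_n | cert_bit y (size x) (n + i)]);
    rewrite ?inE //.
  move=> a b; rewrite !inE => aC ab.
  have /allP /(_ _ (iota_ord b)) /implyP := closed _ (iota_ord a).
  by apply; rewrite aC.
rewrite leqNgt; apply/negP => /alpha_gt_indep [l [sz_l ul lS lind]].
(* The quantifiers accumulate their values in reverse order, so the reversed list is supplied. *)
have := noind (rev (map val l)); rewrite size_rev size_map sz_l => /(_ erefl).
rewrite all_rev catrevE revK cats0 => H; suff : false by [].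
have /negP : ~~ indep_list y n (size x) (map val l).
  by apply: H; apply/allP => _ /mapP[a _ ->]; apply: ltn_ord.
case; apply/andP; split.
  by apply/allP => _ /mapP[a /lS + ->]; rewrite inE.
apply/(pairwiseP 0) => i j; rewrite !inE size_map => lt_i lt_j lt_ij.
rewrite nth_uniq ?size_map ?map_inj_uniq //; last exact: val_inj.
rewrite ltn_eqF //= !(nth_map u) //.
by apply: lind; apply: mem_nth.
Qed.

Theorem small_alpha_separator_NP k : in_NP (small_alpha_separator k).
Proof.
exists (verifier k), ('X + 'X)%R; split; first exact: verifier_poly_time.
have pE n : ('X + 'X : {poly nat}).[n]%R = 2 * n.
  by rewrite hornerD hornerX mul2n -addnn.
move=> x; rewrite pE; split; first exact: verifier_complete.
by case=> w [_]; apply: verifier_sound.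
Qed.

Theorem theorem17 (k : nat) (hk : (3 <= k)%N) :
  NP_complete (small_alpha_separator k).
Proof.
by split; [apply: small_alpha_separator_NP | apply: small_alpha_separator_NP_hard].
Qed.
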